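(* Let $X=(X(t))_{t\ge 0}$ be a regenerative random process with regeneration epochs $S_k=T_1+\cdots+T_k$, $S_0=0$, such that $\mathbf{P}(X(t)\in\{0,1,2,3,\ldots\})=1$ for all $t\ge0$, and let $\bar X(t)=\sup_{0\le s<t}X(s)$. For $k=0,1,2,\ldots$ put $R_k=-\log\mathbf{P}(\bar X(T_1)>k)$. Assume that there exist functions $R_0,R_1:\mathbb{R}\to\mathbb{R}$ such that $R_k=R_0(k)+R_1(k)$ for all $k=0,1,2,\ldots$, such that $|R_1(k)|\le C_1<\infty$ for all $k=0,1,2,\ldots$ and some constant $C_1$, and such that $R_0$ satisfies condition $(\mathbb{U})$. Suppose also that $\alpha_T:=\mathbf{E}T_1<\infty$. For large enough $x$ let $r_0(x)=R_0'(x)$ and, for large enough $t$, let $A_0(t)=R_0^{-1}\left(\log\frac{t}{\alpha_T}\right)$. (i) If $r_0(R_0^{-1}(x))=o(\log x)$ as $x\to\infty$, then $$\limsup_{t\to\infty}\frac{r_0(A_0(t))\,(\bar X(t)-A_0(t))}{\log\log t}=1\quad\text{a.s.}$$ (ii) If $r_0(R_0^{-1}(x))=o(\log\log x)$ as $x\to\infty$, then $$\liminf_{t\to\infty}\frac{r_0(A_0(t))\,(\bar X(t)-A_0(t))}{\log\log\log t}=-1\quad\text{a.s.}$$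
   Context: Regenerative process: $X=(X(t))_{t\ge0}$ is a random process of the form $X(t)=\xi_k(t-S_{k-1})$ for $t\in[S_{k-1},S_k)$, $k\in\mathbb{N}$, where $S_0=0$, $S_k=T_1+\cdots+T_k$, and $(T_k,\xi_k(\cdot))_{k\in\mathbb{N}}$ is a sequence of independent copies of a pair $(T,\xi(\cdot))$ consisting of a positive random variable $T$ and a random process $\xi(\cdot)$. The interval $[S_{k-1},S_k)$ is the $k$-th period of regeneration, and $\bar X(T_1)=\sup_{0\le s<T_1}X(s)$ is the maximum over the first period. Generalized inverse: for $H:\mathbb{R}\to\mathbb{R}$, $H^{-1}(y)=\inf\{x\in\mathbb{R}:H(x)>y\}$. Regular variation: a positive measurable function $U$ defined in a neighbourhood of $+\infty$ is regularly varying at $+\infty$ with index $\kappa\in\mathbb{R}$ if $U(x)=x^\kappa V(x)$ where $\lim_{t\to+\infty}V(tx)/V(t)=1$ for all $x>0$. Condition $(\mathbb{U})$: a function $H:\mathbb{R}\to\mathbb{R}$ satisfies condition $(\mathbb{U})$ if (1) $\lim_{x\to+\infty}H(x)=+\infty$; (2) $H$ is eventually (i.e. for all sufficiently large arguments) nondecreasing and differentiable; (3) with $h(x)=H'(x)$, the function $\hat h(x)=(H^{-1}(x))'=\frac{1}{h(H^{-1}(x))}$ (for large $x$) is regularly varying at $+\infty$ with some index $\kappa\in\mathbb{R}$. Convention: such $H$ is eventually strictly increasing and, for large arguments, $H^{-1}$ is understood to coincide with the usual inverse of $H$ restricted to a neighbourhood of $+\infty$. *)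

(* Defs.v *)
From mathcomp Require Import all_boot all_order all_algebra.
From mathcomp Require Import finmap.
From mathcomp Require Import all_classical all_reals all_analysis.
From mathcomp Require Import measurable_realfun.

Set Implicit Arguments.
Unset Strict Implicit.
Unset Printing Implicit Defensive.

Import Order.TTheory GRing.Theory Num.Theory.
Import numFieldNormedType.Exports.

Local Open Scope classical_set_scope.
Local Open Scope ring_scope.

(* The supremum is taken in [\bar R], so that it is meaningful for paths that
   are unbounded on [0, t[. *)
Definition runmax (R : realType) (f : R -> R) (t : R) : \bar R :=
  ereal_sup [set (f s)%:E | s in `[0, t[].

(* The supremum of a path over an interval is not measurable for the sigma-
   algebra generated by the coordinates alone. Paths are therefore equipped with
   the sigma-algebra generated by the coordinates f s and the running suprema
   runmax f s, s >= 0: a random element of [sample_path R] is a process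
   whose running supremum is a random variable at each time, and the law of a
   process determines that of its running supremum. (On right-continuous paths
   this is the sigma-algebra of the coordinates.)  The values of a path at
   negative times are irrelevant. *)
Definition path_generators (R : realType) : set (set (R -> R)) :=
  [set A | exists2 s : R, 0 <= s &
     (exists2 B : set R, measurable B & A = [set f | B (f s)]) \/
     (exists2 B : set (\bar R), measurable B & A = [set f | B (runmax f s)])].

Definition sample_path (R : realType) := g_sigma_algebraType (@path_generators R).

Section Regenerative.
Context {d : measure_display} {Omega : measurableType d} {R : realType}.
Variable P : probability Omega R.

Definition mutually_independent {d' : measure_display} {E : measurableType d'}
    (Y : nat -> {RV P >-> E}) : Prop :=
  forall (J : {fset nat}) (B : nat -> set E),
    (forall k, k \in J -> measurable (B k)) ->
    P (\bigcap_(k in [set` J]) Y k @^-1` B k) =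
    (\prod_(k <- J) P (Y k @^-1` B k))%E.

Definition identically_distributed {d' : measure_display}
    {E : measurableType d'} (Y : nat -> {RV P >-> E}) : Prop :=
  forall (k : nat) (B : set E), measurable B ->
    distribution P (Y k) B = distribution P (Y 0%N) B.

(* [Y k] is the pair (T_(k+1), xi_(k+1)). *)
Definition period (Y : nat -> {RV P >-> (R * sample_path R)%type}) (k : nat)
    (w : Omega) : R := (Y k w).1.

Definition cycle_path (Y : nat -> {RV P >-> (R * sample_path R)%type}) (k : nat)
    (w : Omega) : R -> R := (Y k w).2.

Definition epoch (Y : nat -> {RV P >-> (R * sample_path R)%type}) (k : nat)
    (w : Omega) : R := \sum_(i < k) period Y i w.

Definition regenerative (Y : nat -> {RV P >-> (R * sample_path R)%type})
    (X : R -> Omega -> R) : Prop :=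
  [/\ forall t, 0 <= t -> measurable_fun setT (X t),
      mutually_independent Y,
      identically_distributed Y,
      forall k w, 0 < period Y k w &
      forall k w t, epoch Y k w <= t < epoch Y k.+1 w ->
        X t w = cycle_path Y k w (t - epoch Y k w)].

End Regenerative.

(* For nondecreasing H this is inf {x | y < H x} (ginv_nondecreasing). When H
   is only eventually increasing, the requirement at all z >= x discards the
   behaviour of H away from +oo, so that for large arguments ginv H is the usual
   inverse of the restriction of H to a neighbourhood of +oo (ginvK). *)
Definition ginv (R : realType) (H : R -> R) (y : R) : R :=
  inf [set x | forall z, x <= z -> y < H z].

Lemma ginv_nondecreasing (R : realType) (H : R -> R) (y : R) :
  {homo H : x z / x <= z} -> ginv H y = inf [set x | y < H x].
Proof.
move=> Hmono; congr inf; apply/seteqP; split=> x /=; first exact.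
by move=> yHx z /Hmono; exact: lt_le_trans.
Qed.

Lemma ginvK (R : realType) (H : R -> R) (a x : R) :
  {in `[a, +oo[ &, {homo H : u v / u < v}} -> a <= x -> ginv H (H x) = x.
Proof.
move=> Hincr ax; rewrite /ginv.
suff -> : [set u | forall z, u <= z -> H x < H z] = `]x, +oo[%classic.
  by rewrite inf_itv.
apply/seteqP; split=> u /=; rewrite in_itv/= andbT.
  by move=> Hu; rewrite ltNge; apply/negP => /Hu; rewrite ltxx.
move=> xu z uz; have xz := lt_le_trans xu uz.
by apply: Hincr; rewrite // in_itv/= andbT// (le_trans ax)// ltW.
Qed.

Definition regularly_varying (R : realType) (U : R -> R) (kappa : R) : Prop :=
  exists (A : R) (V : R -> R),
    [/\ forall x, A < x -> 0 < U x,
        measurable_fun `]A, +oo[ U,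
        forall x, A < x -> U x = x `^ kappa * V x &
        forall x, 0 < x -> V (t * x) / V t @[t --> +oo] --> (1 : R)].

(* The function that varies regularly is the derivative of the inverse of H,
   written 1 / h (H^-1 x) with h = H'. Its eventual positivity, part of
   [regularly_varying], makes H eventually strictly increasing. *)
Definition conditionU (R : realType) (H : R -> R) : Prop :=
  [/\ H x @[x --> +oo] --> +oo,
      exists a : R, forall x y, a <= x -> x <= y -> H x <= H y,
      \forall x \near +oo, derivable H x 1 &
      exists kappa : R,
        regularly_varying (fun x => ((H^`())%classic (ginv H x))^-1) kappa].

(* f = o(g) at +oo. This is the unfolded form of f =o_F g, which does not
   apply to pinfty_nbhs because the latter has no canonical filter_on. *)
Definition littleo_pinfty (R : realType) (f g : R -> R) : Prop :=
  forall eps : R, 0 < eps -> \forall x \near +oo, `|f x| <= eps * `|g x|.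

(* Main.v *)
(* Let M_1, M_2, ... be the maxima over the periods; they are i.i.d. and
   P(M > g(x) +- 1) is of order e^-x, where g is the inverse of R0. At a
   regeneration epoch S_k the running maximum is max(M_1, ..., M_k), and S_k
   stays between two multiples of k, so up to an additive constant log t may be
   replaced by log k. The Borel-Cantelli lemmas, along k = 2^n (and along
   k = 2^(n^2) with independent blocks for the liminf), locate max(M_1, ..., M_k)
   at levels g(x + y l(x)) +- 1, where x = log k and l is log or log log. Since
   g' = 1 / r0(g) varies regularly, the uniform convergence theorem turns
   g(x + y l(x)) into g(x) + y l(x) g'(x) (1 + o(1)), and the hypothesis
   r0(g) = o(l) makes the rounding by 1, due to integer levels, negligible. *)
From HB Require Import structures.
Require Import Defs.
From mathcomp Require Import all_boot all_order all_algebra.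
From mathcomp Require Import finmap.
From mathcomp Require Import all_classical all_reals all_analysis.
From mathcomp Require Import measurable_realfun.
From mathcomp Require Import ring lra.

Set Implicit Arguments.
Unset Strict Implicit.
Unset Printing Implicit Defensive.

Import Order.TTheory GRing.Theory Num.Theory.
Import numFieldNormedType.Exports.

Local Open Scope classical_set_scope.
Local Open Scope ring_scope.

(** * Regular variation and inverses *)

(** Probability enters only through almost sure statements on the levels exceeded by the i.i.d.
    period maxima; the passage to the running maximum is then made path by path. Three logarithms
    meet there: that of the index [k] fixing the level, [ln (t / alphaT)] in the centring, and
    [ln t] in the normalization. Linear growth of the epochs keeps them within a constant of each
    other, so the expansion of [g] is proved uniformly over arguments at bounded distance. Bounds
    valid for all large [t] follow from dyadic indices by monotonicity. Bounds attained infinitely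
    often need independent events with a divergent series. For the limsup these are records of
    single periods, of probability at least of order [1 / (i * ln i)]. For the liminf, maxima over
    nested initial segments are dependent; with [k = 2 ^ (n ^ 2)] the segment up to
    [2 ^ ((n - 1) ^ 2)] is so short that it exceeds the [n]-th level only finitely often, and what
    remains are disjoint blocks, each staying below its level with probability at least [1 / n]. *)

Lemma lebesgue_measure_shift (R : realType) (a : R) (A : set R) :
  measurable A ->
  lebesgue_measure [set x | A (x - a)] = lebesgue_measure A.
Proof.
move=> mA.
have ms : measurable_fun setT ((fun x : R => x - a) : _ -> measurableTypeR R).
  exact: measurable_funB.
rewrite -[LHS]/(pushforward lebesgue_measure
  ((fun x : R => x - a) : _ -> measurableTypeR R) A).
apply/esym/lebesgue_measure_unique => //= _ [[u v]] _ <-.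
rewrite /pushforward/=.
have -> : (fun x : R => x - a) @^-1` `]u, v] = `]u + a, v + a]%classic.
  by apply/seteqP; split=> x /=; rewrite !in_itv/= ltrBrDr lerBlDr.
rewrite !lebesgue_measure_itv/= !lte_fin ltrD2r.
by case: ifP => // _; rewrite -!EFinD opprD addrACA subrr addr0.
Qed.

(* Karamata's uniform convergence theorem, by Egorov: near any two translates
   of [1, 3] the increments are uniformly small off a set of measure < 1, so
   some common point lies outside both exceptional sets. *)
Lemma slow_increment_uniform (R : realType) (g : R -> R) :
  measurable_fun setT g ->
  (forall u, g (s + u) - g s @[s --> +oo] --> (0 : R)) ->
  forall e : R, 0 < e -> exists X : R,
    forall s u, X <= s -> `|u| <= 1 -> `|g (s + u) - g s| < e.
Proof.
move=> mg gu e e0; apply: contrapT => /forallNP nX.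
have {nX} /choice[su suP] : forall n : nat, exists p : R * R,
    [/\ n%:R <= p.1, `|p.2| <= 1 & e <= `|g (p.1 + p.2) - g p.1|].
  move=> n; have /existsNP[s /existsNP[u /not_implyP[ns /not_implyP[u1 H]]]] :=
    nX n%:R.
  by exists (s, u); split=> //=; rewrite leNgt; exact/negP.
pose s n := (su n).1; pose u n := (su n).2.
have sy : s n @[n --> \oo] --> +oo.
  apply/cvgryPge => A; near=> n.
  have [+ _ _] := suP n; apply: le_trans.
  by near: n; exact: nbhs_infty_ger.
have suy : s n + u n @[n --> \oo] --> +oo.
  apply/cvgryPge => A; near=> n.
  have [ns u1 _] := suP n; rewrite -/(s n) -/(u n) in ns u1.
  rewrite -(subrK 1 A) -(opprK 1) addrC (opprK 1).
  have uN1 : -1 <= u n by move: u1; rewrite ler_norml => /andP[].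
  have nA : A + 1 <= n%:R by near: n; exact: nbhs_infty_ger.
  lra.
have unif (r : nat -> R) : r n @[n --> \oo] --> +oo ->
  exists B : set R, [/\ measurable B, (lebesgue_measure B < 1)%E &
    \forall n \near \oo, forall y, 0 <= y <= 4 -> ~ B y ->
      `|g (r n + y) - g (r n)| < e / 2].
  move=> ry.
  have [||||B [mB B1 Bu]] := @pointwise_almost_uniform _ R _
     (@lebesgue_measure R) (fun n y => g (r n + y) - g (r n)) (cst 0)
     `[0, 4]%classic 1 _ _ _ _ ltr01.
  - move=> n; apply: measurable_funTS; apply: measurable_funB => //.
    by apply: measurableT_comp => //; exact: measurable_funD.
  - exact: measurable_itv.
  - have := @lebesgue_measure_itv R `[0, 4]; rewrite /= lte_fin ltr0n/= => ->.
    by rewrite -EFinD ltry.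
  - move=> y _; exact: (cvg_comp _ _ ry (gu y)).
  exists B; split=> //.
  have e20 : 0 < e / 2 by rewrite divr_gt0.
  have := Bu [set h | forall y, (`[0, 4]%classic `\` B) y ->
    ball (0 : R) (e / 2) (h y)].
  case.
    apply/uniform_nbhs; exists [set xy | ball xy.1 (e / 2) xy.2].
    by split; [exact: (@entourage_ball R R (PosNum e20))|].
  move=> N _ Nh; exists N => // n Nn y y04 By.
  have := Nh n Nn y; rewrite /ball/= sub0r normrN; apply.
  by split => //=; rewrite in_itv.
have [B1 [mB1 B1lt B1P]] := unif _ sy.
have [B2 [mB2 B2lt B2P]] := unif _ suy.
near \oo => n.
have H1 : forall y : R, 0 <= y <= 4 -> ~ B1 y ->
  `|g (s n + y) - g (s n)| < e / 2 by near: n.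
have H2 : forall y : R, 0 <= y <= 4 -> ~ B2 y ->
  `|g (s n + u n + y) - g (s n + u n)| < e / 2 by near: n.
have mB2u : measurable [set y : R | B2 (y - u n)].
  rewrite -[X in measurable X]setTI.
  have mf : measurable_fun setT (fun y : R => y - u n) by exact: measurable_funB.
  exact: mf.
(* [[1, 3]] has length 2, while the two exceptional sets have total measure below 2. Since
   [|u n| <= 1], both [y] and [y - u n] lie in [[0, 4]], the interval on which Egorov's theorem was
   applied. The value of [g] at [s n + y] is then within [e / 2] of both [g (s n)] and
   [g (s n + u n)]. *)
have [y [y13 yB1 yB2]] : exists y, [/\ 1 <= y <= 3, ~ B1 y & ~ B2 (y - u n)].
  apply: contrapT => /forallNP noy.
  have : (lebesgue_measure `[1%R : R, 3%R]%classic <=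
    lebesgue_measure (B1 `|` [set y | B2 (y - u n)%R]))%E.
    apply: le_measure; rewrite ?inE.
    - exact: measurable_itv.
    - exact: measurableU.
    - move=> y /=; rewrite in_itv/= => y13.
      apply: contrapT => /not_orP[yB1 yB2].
      by apply: (noy y).
  apply/negP; rewrite -ltNge.
  have := @lebesgue_measure_itv R `[1, 3]; rewrite /= lte_fin ltr1n/= => ->.
  apply: le_lt_trans (measureU2 _ _ _) _ => //.
  rewrite [X in (_ + X < _)%E](lebesgue_measure_shift (u n) mB2).
  rewrite (_ : 3 + (-1)%:E = (1 + 1)%:E)%E; last by rewrite -EFinD; congr EFin; ring.
  by rewrite EFinD lteD.
have [_ u1] := suP n; apply/negP; rewrite -ltNge -/(s n) -/(u n).
rewrite -/(u n) in u1.
have un : -1 <= u n <= 1 by rewrite -ler_norml.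
have P1 := H1 y _ yB1; have P2 := H2 (y - u n) _ yB2.
have {}P1 : `|g (s n + y) - g (s n)| < e / 2 by apply: P1; lra.
have {}P2 : `|g (s n + u n + (y - u n)) - g (s n + u n)| < e / 2.
  by apply: P2; lra.
rewrite (_ : s n + u n + (y - u n) = s n + y) in P2; last by ring.
rewrite distrC in P2; rewrite -(subrKA (g (s n + y))).
rewrite (le_lt_trans (ler_normD _ _))//.
move: P1 P2; set a := `|_|; set b := `|_|; lra.
Unshelve. all: by end_near.
Qed.

Lemma cvg_expR_pinfty (R : realType) : expR x @[x --> +oo] --> (+oo : set_system R).
Proof.
apply/cvgryPge => A; near=> x.
rewrite (le_trans _ (expR_ge1Dx x))// -lerBlDl.
by near: x; apply: nbhs_pinfty_ge; exact: num_real.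
Unshelve. all: by end_near.
Qed.

Lemma cvg_ln_pinfty (R : realType) : ln x @[x --> +oo] --> (+oo : set_system R).
Proof.
apply/cvgryPge => A; near=> x.
have Ax : expR A <= x by near: x; apply: nbhs_pinfty_ge; exact: num_real.
by rewrite -ler_expR lnK// posrE (lt_le_trans (expR_gt0 A)).
Unshelve. all: by end_near.
Qed.

Lemma littleo_ln (R : realType) (e : R) : 0 < e ->
  \forall x \near +oo, ln x <= e * x.
Proof.
move=> e0; near=> x.
have x0 : 0 < x by near: x; apply: nbhs_pinfty_gt; exact: num_real.
have e20 : 0 < e / 2 by rewrite divr_gt0.
have := ln_sublinear (mulr_gt0 e20 x0).
rewrite lnM ?posrE// => exln.
have : - ln (e / 2) <= (e / 2) * x.
  rewrite -ler_pdivrMl//; near: x; apply: nbhs_pinfty_ge; exact: num_real.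
lra.
Unshelve. all: by end_near.
Qed.

(** In the variable [s = ln x], the function [ln U - kappa * s] is [ln V], whose increments over a
    fixed shift tend to 0, so the uniform convergence theorem applies to it. The remaining factor
    [(y / x) ^ kappa] is close to 1 only if [y / x] is, whence the small [d]. *)
Lemma regularly_varying_locally_uniform (R : realType) (U : R -> R) (kappa : R) :
  regularly_varying U kappa -> forall e : R, 0 < e ->
  exists2 d : R, 0 < d &
    \forall x \near +oo, forall y, `|y - x| <= d * x -> `|U y / U x - 1| <= e.
Proof.
move=> [A [V [U0 mU UV Vslow]]] e e0.
(* [U] is known to be measurable only beyond [A]; restricting there and extending by a constant
   makes [g] measurable on the whole line. *)
pose g s := ((@ln R \o U) \_ `]A, +oo[%classic) (expR s) - kappa * s.
have gE s : A < expR s -> g s = ln (U (expR s)) - kappa * s.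
  by move=> As; rewrite /g patchE mem_set//= in_itv/= As.
have mg : measurable_fun setT g.
  apply: measurable_funB; last exact: measurable_funM.
  apply: (measurableT_comp _ (@measurable_expR R)).
  by apply/(measurable_restrictT _ _).1 => //; exact: measurableT_comp.
have gV s : A < expR s -> g s = ln (V (expR s)).
  move=> As; rewrite gE// UV// lnM ?posrE ?powR_gt0 ?expR_gt0//; last first.
    by have := U0 _ As; rewrite UV// pmulr_rgt0// powR_gt0// expR_gt0.
  by rewrite ln_powR expRK addrAC subrr add0r.
have V0 s : A < s -> 0 < s -> 0 < V s.
  by move=> As s0; have := U0 _ As; rewrite UV// pmulr_rgt0// powR_gt0.
have exply := @cvg_expR_pinfty R.
have gu u : g (s + u) - g s @[s --> +oo] --> (0 : R).
  have : ln (V (expR s * expR u) / V (expR s)) @[s --> +oo] --> ln (1 : R).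
    apply: continuous_cvg; first exact: continuous_ln.
    exact: (cvg_comp _ _ exply (Vslow _ (expR_gt0 u))).
  rewrite ln1; apply: cvg_trans; apply: near_eq_cvg; near=> s.
  have As : A < expR s by near: s; move/cvgryPgt : exply; apply.
  have Asu : A < expR (s + u).
    rewrite expRD -ltr_pdivrMr ?expR_gt0//.
    by near: s; move/cvgryPgt : exply; apply.
  by rewrite !gV// ln_div ?posrE ?V0 ?mulr_gt0 ?expR_gt0// -?expRD.
have [h h0 eh] : exists2 h : R, 0 < h & forall z, `|z| < h -> `|expR z - 1| <= e.
  have : expR z @[z --> (0 : R)] --> (1 : R).
    by rewrite -[X in _ --> X]expR0; exact: continuous_expR.
  move=> /cvgr_dist_le /(_ _ e0) /nbhs_ballP[h /= h0 H].
  by exists h => // z zh; rewrite distrC; apply: H; rewrite /ball/= sub0r normrN.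
have [X gX] := slow_increment_uniform mg gu (divr_gt0 h0 (ltr0n _ 2)).
have h20 : 0 < h / 2 by rewrite divr_gt0.
(* With [r = y / x]: the first bound keeps [y] positive and beyond [A], the second makes [ln r] an
   admissible shift for the uniform estimate, and the third leaves half of [h] to that estimate. *)
have [d d0 dP] : exists2 d : R, 0 < d & forall r : R, `|r - 1| <= d ->
    [/\ 1 / 2 < r, `|ln r| <= 1 & `|kappa * ln r| < h / 2].
  have cln : ln r @[r --> (1 : R)] --> (0 : R).
    by rewrite -[X in _ --> X](@ln1 R); exact: continuous_ln.
  have ckln : kappa * ln r @[r --> (1 : R)] --> (0 : R).
    by rewrite -[X in _ --> X](mulr0 kappa); exact: cvgMr.
  have : \forall r \near (1 : R),
      [/\ 1 / 2 < r, `|ln r| <= 1 & `|kappa * ln r| < h / 2].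
    near=> r; split.
    - by near: r; apply: lt_nbhsr; lra.
    - by rewrite -[ln r]subr0 distrC; near: r; exact: cvgr_dist_le.
    - by rewrite -[kappa * ln r]subr0 distrC; near: r; exact: cvgr_dist_lt.
  move=> /nbhs_ballP[d /= d0 H].
  exists (d / 2) => [|r rd]; first by rewrite divr_gt0.
  by apply: H; rewrite /ball/= distrC (le_lt_trans rd)// gtr_pMr// invf_lt1// ltr1n.
exists d => //; near=> x => y xy.
have x0 : 0 < x by near: x; apply: nbhs_pinfty_gt; exact: num_real.
have [yx0 ln1 lnk] : [/\ 1 / 2 < y / x, `|ln (y / x)| <= 1 &
    `|kappa * ln (y / x)| < h / 2].
  apply: dP; rewrite -[X in _ - X](divff (lt0r_neq0 x0)) -mulrBl normrM.
  by rewrite normfV (gtr0_norm x0) ler_pdivrMr.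
have xy2 : x / 2 < y by move: yx0; rewrite ltr_pdivlMr//; lra.
have y0 : 0 < y by lra.
have Ax : A < x by near: x; apply: nbhs_pinfty_gt; exact: num_real.
have Ay : A < y.
  have : A * 2 < x by near: x; apply: nbhs_pinfty_gt; exact: num_real.
  lra.
have Xx : X <= ln x by near: x; move/cvgryPge : (@cvg_ln_pinfty R); apply.
have := gX _ _ Xx ln1.
rewrite ln_div ?posrE// [ln x + _]addrC subrK.
rewrite !gE ?lnK ?posrE// => gxy.
rewrite -[U y / U x]lnK ?posrE ?divr_gt0 ?U0//; apply: eh.
rewrite ln_div ?posrE ?U0//.
move: lnk; rewrite ln_div ?posrE// => lnk.
rewrite (_ : _ - _ = (ln (U y) - kappa * ln y - (ln (U x) - kappa * ln x)) +
  kappa * (ln y - ln x)); last by ring.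
by rewrite (le_lt_trans (ler_normD _ _))// [ltRHS](splitr h) ltrD.
Unshelve. all: by end_near.
Qed.

(** A positive derivative at [x] rules out a plateau ending at [x]; this turns eventual monotonicity
    into strict monotonicity in [conditionU_ginv]. *)
Lemma derive1_gt0_left (R : realType) (f : R -> R) (x a : R) :
  derivable f x 1 -> 0 < (f^`())%classic x -> a < x ->
  exists2 z, a < z < x & f z != f x.
Proof.
move=> df; rewrite derive1E => f0 ax.
have := df; rewrite /derivable => /cvg_ex[l fl].
have {}f0 : 0 < l by move: f0; rewrite /derive (cvg_lim _ fl).
move/cvgr_gt : fl => /(_ 0 f0).
rewrite /dnbhs /within/= => /nbhs_ballP[e /= e0 H].
pose h := Num.min (e / 2) ((x - a) / 2).
have h0 : 0 < h by rewrite lt_min !divr_gt0// subr_gt0.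
have he : h < e by rewrite gt_min ltr_pdivrMr// ltr_pMr// ltr1n.
have hxa : h < x - a.
  by rewrite gt_min orbC ltr_pdivrMr// ltr_pMr ?subr_gt0// ltr1n.
exists (x - h); first by rewrite ltrBrDr gtrBl h0 andbT -ltrBrDl.
have := H (- h); rewrite /ball/= sub0r opprK (gtr0_norm h0) he oppr_eq0.
rewrite (gt_eqF h0) => /(_ isT isT); rewrite scaler1 [- h + x]addrC.
by apply: contraTN => /eqP ->; rewrite subrr scaler0 ltxx.
Qed.

(** Beyond [X0], continuity of [H] makes [ginv H] a right inverse, and the positivity contained in
    regular variation makes [H] strictly increasing. The last clause is the mean value theorem for
    [ginv H], obtained from the one for [H], so that no differentiability of [ginv H] has to be
    established. *)
Lemma conditionU_ginv (R : realType) (H : R -> R) : conditionU H ->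
  exists b X0 : R,
  [/\ forall u v, b <= u -> u <= v -> H u <= H v,
      forall x, X0 <= x ->
        [/\ b <= ginv H x, H (ginv H x) = x & 0 < (H^`())%classic (ginv H x)],
      ginv H x @[x --> +oo] --> +oo &
      forall x y, X0 <= x -> x < y -> exists2 z, x < z < y &
        ginv H y - ginv H x = (y - x) / (H^`())%classic (ginv H z)].
Proof.
move=> [Hy [a Ha] [M [_ dH]] [kappa [A [_ [U0 _ _ _]]]]].
pose b := Num.max a (M + 1).
have Hb u v : b <= u -> u <= v -> H u <= H v.
  by move=> bu; apply: Ha; rewrite (le_trans _ bu)// le_max lexx.
have dHb u : b <= u -> derivable H u 1.
  move=> bu; apply: dH; rewrite (lt_le_trans _ bu)// lt_max.
  by rewrite ltrDl ltr01 orbT.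
have cH u : b <= u -> {for u, continuous H}.
  by move=> /dHb/derivable1_diffP/differentiable_continuous.
pose X0 := Num.max (H b) A + 1.
have X0b x : X0 <= x -> H b < x.
  by apply: lt_le_trans; rewrite ltr_pwDr// le_max lexx.
have X0A x : X0 <= x -> A < x.
  by apply: lt_le_trans; rewrite ltr_pwDr// le_max lexx orbT.
pose S x := [set u | forall z, u <= z -> x < H z].
have Sb x u : X0 <= x -> S x u -> b <= u.
  move=> /X0b Hbx Su; rewrite leNgt; apply/negP => /ltW/Su.
  by rewrite ltNge (ltW Hbx).
have S0 x : S x !=set0.
  have /cvgryPgt/(_ x)[N [_ HN]] := Hy.
  exists (N + 1) => z Nz; apply: HN.
  by rewrite (lt_le_trans _ Nz)// ltrDl.
have Sinf x : X0 <= x -> has_inf (S x).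
  by move=> Xx; split; [exact: S0|exists b => u; exact: Sb].
have bg x : X0 <= x -> b <= ginv H x.
  by move=> Xx; apply: lb_le_inf; [exact: S0|move=> u; exact: Sb].
have Hg x : X0 <= x -> H (ginv H x) = x.
  move=> Xx; have cg := cH _ (bg _ Xx); apply/eqP.
  rewrite eq_le !leNgt; apply/andP; split; apply/negP => Hx.
    have /nbhs_ballP[e /= e0 He] : \forall z \near ginv H x, x < H z.
      by apply: (cvgr_gt _ cg).
    have bgx : b < ginv H x.
      rewrite lt_neqAle bg// andbT; apply: contraTN Hx => /eqP <-.
      by rewrite -leNgt ltW// X0b.
    pose z := Num.max b (ginv H x - e / 2).
    have zg : z < ginv H x by rewrite gt_max bgx gtrBl divr_gt0.
    suff : S x z by move=> /(ge_inf (Sinf _ Xx).2); rewrite leNgt zg.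
    move=> u zu; apply: (@lt_le_trans _ _ (H z)).
      apply: He; rewrite /ball/= ger0_norm ?subr_ge0 ?(ltW zg)//.
      rewrite ltrBlDl -ltrBlDr lt_max; apply/orP; right.
      by rewrite ltrD2l ltrN2 ltr_pdivrMr// ltr_pMr// ltr1n.
    by apply: Hb => //; rewrite le_max lexx.
  have /nbhs_ballP[e /= e0 He] : \forall z \near ginv H x, H z < x.
    by apply: (cvgr_lt _ cg).
  have [u Su ug] := inf_adherent e0 (Sinf _ Xx).
  have gu : ginv H x <= u by apply: (ge_inf (Sinf _ Xx).2).
  have := Su u (lexx _); apply/negP; rewrite -leNgt ltW//.
  apply: He; rewrite /ball/= distrC ger0_norm ?subr_ge0//.
  by rewrite ltrBlDl.
have r0 x : X0 <= x -> 0 < (H^`())%classic (ginv H x).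
  by move=> /X0A/U0; rewrite invr_gt0.
(* If [H p = H q], no point up to [q] belongs to the set defining [ginv H (H p)], so
   [q <= ginv H (H p)]. Then [H] is constant from [p] to [ginv H (H p)], where its derivative is
   positive: a contradiction. *)
have Hlt p q : b <= p -> X0 <= H p -> p < q -> H p < H q.
  move=> bp Xp pq; rewrite lt_neqAle Hb ?(ltW pq)// andbT.
  apply/negP => /eqP Hpq.
  have qg : q <= ginv H (H p).
    apply: lb_le_inf; first exact: S0.
    move=> u Su; rewrite leNgt; apply/negP => /ltW/Su.
    by rewrite Hpq ltxx.
  have [z /andP[pz zg]] := derive1_gt0_left (dHb _ (bg _ Xp)) (r0 _ Xp)
    (lt_le_trans pq qg).
  rewrite Hg// => /eqP; apply; apply/eqP; rewrite eq_le.
  rewrite -{1}[in leRHS](Hg _ Xp) !Hb ?(ltW pz) ?(ltW zg)//.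
  by rewrite (le_trans bp (ltW pz)).
exists b, X0; split => //.
  by move=> x Xx; split; [exact: bg|exact: Hg|exact: r0].
  apply/cvgryPge => v; near=> x.
  have Xx : X0 <= x by near: x; apply: nbhs_pinfty_ge; exact: num_real.
  have : H (Num.max b v) < x.
    by near: x; apply: nbhs_pinfty_gt; exact: num_real.
  apply: contraTT; rewrite -ltNge -leNgt => gv.
  by rewrite -[leLHS](Hg _ Xx) Hb ?bg// le_max (ltW gv) orbT.
move=> x y Xx xy.
have Xy : X0 <= y by rewrite (le_trans Xx (ltW xy)).
have gxy : ginv H x < ginv H y.
  rewrite ltNge; apply: contraTN xy => gyx.
  by rewrite -leNgt -(Hg _ Xx) -{1}(Hg _ Xy) Hb// bg.
have bz z : z \in `]ginv H x, ginv H y[ -> b <= z.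
  by rewrite in_itv/= => /andP[gz _]; rewrite (le_trans (bg _ Xx) (ltW gz)).
(* The intermediate point [c] lies between [ginv H x] and [ginv H y]; the point sought is [z = H c],
   for which [ginv H z = c]. *)
have [||c cg] := @MVT R H (H^`())%classic _ _ gxy.
- move=> z /bz zb; rewrite derive1E; exact/derivableP/dHb.
- apply: continuous_in_subspaceT => z; rewrite inE/= in_itv/= => /andP[gz _].
  by apply: cH; rewrite (le_trans (bg _ Xx)).
rewrite !Hg// => xyE.
move: (cg); rewrite in_itv/= => /andP[gc cgy].
have xc : x < H c by rewrite -{1}(Hg _ Xx) Hlt ?bg ?Hg.
have cy : H c < y.
  by rewrite -(Hg _ Xy) Hlt ?(bz _ cg)// (le_trans Xx (ltW xc)).
exists (H c); first exact/andP.
have -> : ginv H (H c) = c.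
  apply: (@ginvK _ H (ginv H x)); last exact: ltW.
  move=> u v; rewrite !in_itv/= !andbT => gu gv uv.
  apply: Hlt => //; first exact: le_trans (bg _ Xx) gu.
  by rewrite (le_trans Xx)// -{1}(Hg _ Xx) Hb// bg.
rewrite xyE mulrAC divff ?mul1r// gt_eqF//.
by rewrite -(pmulr_lgt0 _ (_ : 0 < ginv H y - ginv H x)) ?subr_gt0// -xyE subr_gt0.
Unshelve. all: by end_near.
Qed.

(** Once [x] exceeds [2 * K], each of [x] and [y] is at most twice the other, and [ln 2 <= 1]. *)
Lemma ln_bounded_shift (R : realType) (K : R) :
  \forall x \near +oo, forall y, `|y - x| <= K -> `|ln y - ln x| <= 1.
Proof.
have ln2 : ln 2 <= 1 :> R.
  by apply: (@le_ln1Dx R 1); lra.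
near=> x => y.
have x0 : 0 < x by near: x; apply: nbhs_pinfty_gt; exact: num_real.
have xK : 2 * K < x by near: x; apply: nbhs_pinfty_gt; exact: num_real.
rewrite ler_norml => /andP[yx xy].
have y0 : 0 < y by lra.
have : ln y <= ln (2 * x) by rewrite ler_ln ?posrE ?mulr_gt0//; lra.
have : ln x <= ln (2 * y) by rewrite ler_ln ?posrE ?mulr_gt0//; lra.
rewrite !lnM ?posrE// ler_norml => ? ?; apply/andP; split; lra.
Unshelve. all: by end_near.
Qed.

Lemma lnln_bounded_shift (R : realType) (K : R) :
  \forall x \near +oo, forall y, `|y - x| <= K -> `|ln (ln y) - ln (ln x)| <= 1.
Proof.
near=> x.
have lnx : forall y, `|y - ln x| <= 1 -> `|ln y - ln (ln x)| <= 1.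
  by near: x; exact: (cvg_ln_pinfty (ln_bounded_shift 1)).
have xK : forall y, `|y - x| <= K -> `|ln y - ln x| <= 1.
  by near: x; exact: ln_bounded_shift.
by move=> y /xK/lnx.
Unshelve. all: by end_near.
Qed.

Lemma littleo_lnln (R : realType) (e : R) : 0 < e ->
  \forall x \near +oo, ln (ln x) <= e * x.
Proof.
move=> e0; near=> x.
have x0 : 1 < x by near: x; apply: nbhs_pinfty_gt; exact: num_real.
rewrite (le_trans (ltW (ln_sublinear (ln_gt0 x0))))//.
by near: x; exact: littleo_ln.
Unshelve. all: by end_near.
Qed.

Lemma cvg_lnln_pinfty (R : realType) :
  ln (ln x) @[x --> +oo] --> (+oo : set_system R).
Proof. exact: cvg_comp (@cvg_ln_pinfty R) (@cvg_ln_pinfty R). Qed.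

(** The arguments have separate roles: [x] centres, [x'] is the logarithm of the index fixing the
    level, [x''] is the argument of the normalization, and [s] is the rounding to integers. With
    [D = x' + y * l x' - x], the mean value theorem gives an increment [D / r z] with [z] within
    [|D| = o(x)] of [x], so [r x / r z] is close to 1 by local uniformity. The rounding contributes
    [s * r x], which is [o(l x)] by the hypothesis on [r]. *)
Lemma ginv_level_asymptotics (R : realType) (H l : R -> R) (K y e : R) :
  conditionU H -> l x @[x --> +oo] --> +oo ->
  (forall e', 0 < e' -> \forall x \near +oo, l x <= e' * x) ->
  (forall K', \forall x \near +oo, forall x', `|x' - x| <= K' ->
     `|l x' - l x| <= 1) ->
  littleo_pinfty (fun x => (H^`())%classic (ginv H x)) l -> 0 < e ->
  \forall x \near +oo, forall x' x'' s, `|x' - x| <= K -> `|x'' - x| <= K ->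
    `|s| <= 1 ->
    `|(H^`())%classic (ginv H x) * (ginv H (x' + y * l x') + s - ginv H x) /
      l x'' - y| <= e.
Proof.
move=> UH ly lo lK ro e0.
have [b [X0 [_ gP _ gmvt]]] := conditionU_ginv UH.
have [_ _ _ [kappa RV]] := UH.
set phi := ginv H in gP gmvt RV ro *.
set r := (fun x : R => (H^`())%classic (phi x)) in ro.
have r0 x : X0 <= x -> 0 < r x by move=> /gP[].
have phimvt u v : X0 <= u -> X0 <= v ->
    exists2 z, `|z - u| <= `|v - u| & phi v - phi u = (v - u) / r z.
  move=> Xu Xv; have [uv|vu|<-] := ltgtP u v.
  - have [z /andP[uz zv] zE] := gmvt _ _ Xu uv; exists z => //.
    by rewrite !ger0_norm ?subr_ge0 ?(ltW uz) ?(ltW uv)// lerD2r ltW.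
  - have [z /andP[vz zu] zE] := gmvt _ _ Xv vu; exists z.
      by rewrite !ler0_norm ?subr_le0 ?(ltW vu) ?(ltW zu)// lerN2 lerD2r ltW.
    by rewrite -opprB zE -mulNr opprB.
  - by exists u; rewrite ?subrr// mul0r.
(* [|D|] is at most [|y| * l x + K + |y|], hence at most [c * l x] as soon as [l x >= K + |y|]. *)
pose c := `|y| + 1.
have c0 : 0 < c by rewrite ltr_wpDl.
have ec0 : 0 < e / (4 * c) by rewrite divr_gt0// mulr_gt0.
have e40 : 0 < e / 4 by rewrite divr_gt0.
have [d d0 Ud] := regularly_varying_locally_uniform RV ec0.
have dc0 : 0 < d / c by rewrite divr_gt0.
near=> x.
have lKx : forall x', `|x' - x| <= K -> `|l x' - l x| <= 1.
  by near: x; exact: lK.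
have Udx : forall z, `|z - x| <= d * x -> `|r x / r z - 1| <= e / (4 * c).
  have : forall z, `|z - x| <= d * x ->
    `|(r z)^-1 / (r x)^-1 - 1| <= e / (4 * c) by near: x; exact: Ud.
  by move=> H' z /H'; rewrite invrK mulrC.
move=> x' x'' s /[dup] x'K /lKx lx' /lKx lx'' s1.
have x0 : 0 < x by near: x; apply: nbhs_pinfty_gt; exact: num_real.
have Xx : X0 <= x by near: x; apply: nbhs_pinfty_ge; exact: num_real.
have lx_ge1 : 1 <= l x by near: x; move/cvgryPge : ly; apply.
have lx_geK : K + `|y| <= l x by near: x; move/cvgryPge : ly; apply.
have lx_geB : 2 / e * (e / 2 + K + 2 * `|y|) + 1 <= l x.
  by near: x; move/cvgryPge : ly; apply.
have rx : r x <= e / 4 * l x.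
  have : `|r x| <= e / 4 * `|l x| by near: x; exact: ro.
  by rewrite gtr0_norm ?r0// ger0_norm// (le_trans ler01).
have lxd : l x <= d / c * x by near: x; exact: lo.
set D := x' + y * l x' - x.
have DE : `|D - y * l x| <= K + `|y|.
  rewrite (_ : D - _ = (x' - x) + y * (l x' - l x)); last by rewrite /D; ring.
  by rewrite (le_trans (ler_normD _ _))// lerD// normrM ler_piMr.
have Dl : `|D| <= c * l x.
  rewrite -(subrK (y * l x) D) (le_trans (ler_normD _ _))//.
  rewrite normrM (ger0_norm (le_trans ler01 lx_ge1)) /c mulrDl mul1r addrC.
  by rewrite lerD2l (le_trans DE).
have Dd : `|D| <= d * x.
  by rewrite (le_trans Dl)// -ler_pdivlMl// mulrA (mulrC c^-1).
have xD : x' + y * l x' = x + D by rewrite /D; ring.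
have XD : X0 <= x + D.
  have lx2 : l x <= (2 * c)^-1 * x.
    by near: x; apply: lo; rewrite invr_gt0 mulr_gt0.
  have : `|D| <= 2^-1 * x.
    rewrite (le_trans Dl)// (le_trans (ler_wpM2l (ltW c0) lx2))//.
    by rewrite invfM mulrA mulrCA divff ?mulr1 ?gt_eqF.
  have : X0 * 2 <= x by near: x; apply: nbhs_pinfty_ge; exact: num_real.
  rewrite ler_norml => ? /andP[? _]; lra.
have [z zD zE] := phimvt _ _ Xx XD.
rewrite addrAC subrr add0r in zD zE.
have Uz : `|r x / r z - 1| <= e / (4 * c).
  by apply: Udx; exact: le_trans zD Dd.
rewrite xD (_ : _ * (_ - phi x) = D * (r x / r z) + s * r x); last first.
  by rewrite [_ + s]addrC -addrA zE -/(r x) mulrDr addrC mulrCA (mulrC (r x) s).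
have lxx'' : l x <= l x'' + 1 by move: lx''; rewrite ler_norml => /andP[]; lra.
have lx''0 : 0 < l x''.
  have : 2 <= l x by near: x; move/cvgryPge : ly; apply.
  lra.
rewrite -[X in _ - X](mulfK (lt0r_neq0 lx''0)) -mulrBl normrM normfV.
rewrite (gtr0_norm lx''0) ler_pdivrMr//.
(* The first two terms are each at most [e / 4 * l x] and the last two are bounded by [K + 2 * |y|].
   The threshold [lx_geB] is chosen so that this constant, together with the cost [e / 2] of
   replacing [l x] by [l x'' + 1], fits into the other half of [e * l x'']. *)
rewrite (_ : D * _ + _ - _ = D * (r x / r z - 1) + s * r x + (D - y * l x) +
  y * (l x - l x'')); last by ring.
have T1 : `|D * (r x / r z - 1)| <= e / 4 * l x.
  rewrite normrM (le_trans (ler_pM _ _ Dl Uz))//.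
  by rewrite le_eqVlt; apply/orP; left; apply/eqP; field; rewrite gt_eqF.
have T2 : `|s * r x| <= e / 4 * l x.
  by rewrite normrM (gtr0_norm (r0 _ Xx)) (le_trans _ rx)// ler_piMl// ltW// r0.
have T3 : `|y * (l x - l x'')| <= `|y|.
  by rewrite normrM ler_piMr// distrC.
apply: (@le_trans _ _ (e / 2 * l x + (K + 2 * `|y|))).
  rewrite (le_trans (ler_normD _ _))//.
  rewrite (le_trans (lerD (ler_normD _ _) (lexx _)))//.
  rewrite (le_trans (lerD (lerD (ler_normD _ _) (lexx _)) (lexx _)))//.
  lra.
have : e / 2 * l x <= e / 2 * (l x'' + 1) by rewrite ler_wpM2l// ltW// divr_gt0.
have : e / 2 + K + 2 * `|y| <= e / 2 * l x''.
  by rewrite -ler_pdivrMl ?divr_gt0// invf_div; lra.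
lra.
Unshelve. all: by end_near.
Qed.

(** * Linear growth of the epochs *)

Section second_moment.
Context {d : measure_display} {Omega : measurableType d} {R : realType}.
Variable P : probability Omega R.
Local Open Scope ereal_scope.

(** By independence the law of the pair agrees with the product of the laws on rectangles, hence
    everywhere; Tonelli's theorem then factors the integral. *)
Lemma indep_integralM (X Y : {RV P >-> R}) (f g : R -> R) :
  (forall A B, measurable A -> measurable B ->
    P (X @^-1` A `&` Y @^-1` B) = P (X @^-1` A) * P (Y @^-1` B)) ->
  measurable_fun setT f -> measurable_fun setT g ->
  (forall x, (0 <= f x)%R) -> (forall x, (0 <= g x)%R) ->
  \int[P]_w (f (X w) * g (Y w))%:E =
  \int[P]_w (f (X w))%:E * \int[P]_w (g (Y w))%:E.
Proof.
move=> XY mf mg f0 g0.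
have mXY : measurable_fun setT (fun w => (X w, Y w)).
  by apply/measurable_fun_pairP; split.
pose XYp : {RV P >-> (R * R)%type} :=
  HB.pack_for {mfun Omega >-> (R * R)%type} (fun w => (X w, Y w))
    (isMeasurableFun.Build _ _ _ _ _ mXY).
have mef : measurable_fun setT (EFin \o f) by exact/measurable_EFinP.
have meg : measurable_fun setT (EFin \o g) by exact/measurable_EFinP.
have mfg : measurable_fun setT (fun p : R * R => (f p.1 * g p.2)%:E).
  apply/measurable_EFinP; apply: measurable_funM; exact: measurableT_comp.
rewrite -[LHS](ge0_integral_distribution XYp mfg); last first.
  by move=> p; rewrite lee_fin mulr_ge0.
rewrite -(@eq_measure_integral _ _ _ _ (distribution P XYp)
  (distribution P X \x distribution P Y)); last first.
  move=> A mA _; exact: product_measure_unique.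
rewrite fubini_tonelli1//=; last by move=> p; rewrite lee_fin mulr_ge0.
rewrite /fubini_F/=.
have fin0 (h : R -> R) (Z : {RV P >-> R}) : (forall x, (0 <= h x)%R) ->
  0 <= \int[P]_w (h (Z w))%:E by move=> h0; apply: integral_ge0 => w _; rewrite lee_fin.
transitivity (\int[distribution P X]_x ((f x)%:E * \int[P]_w (g (Y w))%:E)).
  apply: eq_integral => x _.
  under eq_integral do rewrite EFinM.
  rewrite ge0_integralZl//; last 2 first.
  - by move=> y _; rewrite lee_fin.
  - by rewrite lee_fin.
  by rewrite ge0_integral_distribution// => y; rewrite lee_fin.
rewrite ge0_integralZr//; last 2 first.
- by move=> x _; rewrite lee_fin.
- exact: fin0.
by rewrite ge0_integral_distribution// => y; rewrite lee_fin.
Qed.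


Lemma integralD_EFin (f g : Omega -> R) :
  measurable_fun setT f -> measurable_fun setT g ->
  (forall x, (0 <= f x)%R) -> (forall x, (0 <= g x)%R) ->
  \int[P]_w (f w + g w)%:E = \int[P]_w (f w)%:E + \int[P]_w (g w)%:E.
Proof.
move=> mf mg f0 g0; under eq_integral do rewrite EFinD.
rewrite ge0_integralD//; try (by move=> x _; rewrite lee_fin);
  exact/measurable_EFinP.
Qed.

Lemma integralZ_EFin (c : R) (f : Omega -> R) :
  measurable_fun setT f -> (forall x, (0 <= f x)%R) -> (0 <= c)%R ->
  \int[P]_w (c * f w)%:E = c%:E * \int[P]_w (f w)%:E.
Proof.
move=> mf f0 c0; under eq_integral do rewrite EFinM.
rewrite ge0_integralZl ?lee_fin//; last by move=> x _; rewrite lee_fin.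
exact/measurable_EFinP.
Qed.

Lemma integral_cst_EFin (c : R) : \int[P]_w c%:E = c%:E.
Proof.
transitivity (c%:E * P setT); first exact: integral_cst.
by rewrite probability_setT mule1.
Qed.

Lemma integral_gt0 (f : Omega -> R) :
  measurable_fun setT f -> (forall w, (0 < f w)%R) -> 0 < \int[P]_w (f w)%:E.
Proof.
move=> mf f0.
have If : 0 <= \int[P]_w (f w)%:E.
  by apply: integral_ge0 => w _; rewrite lee_fin ltW.
rewrite lt_neqAle If andbT; apply/negP => /eqP I0.
have mEf : measurable_fun setT (EFin \o f) by exact/measurable_EFinP.
have : ae_eq P setT (EFin \o f) (cst 0).
  apply/(ae_eq_integral_abs P measurableT mEf).
  rewrite [RHS]I0; apply: eq_integral => w _.
  by rewrite /= gtr0_norm.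
move=> [B [mB B0 fB]].
have : P setT <= P B.
  apply: le_measure; rewrite ?inE// => w _; apply: fB => /= /(_ I) [].
  by apply/eqP; rewrite gt_eqF.
by rewrite B0 probability_setT lee_fin ler10.
Qed.

Variables (Z : nat -> Omega -> R) (m v : R).
Hypotheses (mZ : forall i, measurable_fun setT (Z i))
  (Z0 : forall i w, (0 <= Z i w)%R)
  (EZ : forall i, \int[P]_w (Z i w)%:E = m%:E)
  (EZ2 : forall i, \int[P]_w (Z i w * Z i w)%:E = v%:E)
  (EZZ : forall i j, i != j -> \int[P]_w (Z i w * Z j w)%:E = (m * m)%:E).

Let S n w := (\sum_(i < n) Z i w)%R.

Let mS n : measurable_fun setT (S n).
Proof. exact: measurable_sum. Qed.

Let S0 n w : (0 <= S n w)%R.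
Proof. exact: sumr_ge0. Qed.

Let SSn n w : (S n.+1 w = S n w + Z n w)%R.
Proof. by rewrite /S big_ord_recr. Qed.

Let ES n : \int[P]_w (S n w)%:E = (n%:R * m)%:E.
Proof.
elim: n => [|n IH].
  rewrite mul0r -(integral_cst_EFin 0).
  by apply: eq_integral => w _; rewrite /S big_ord0.
under eq_integral do rewrite SSn.
rewrite integralD_EFin//.
by rewrite EZ IH -EFinD; congr EFin; rewrite -natr1; ring.
Qed.

Let ESZ n k : (n <= k)%N -> \int[P]_w (S n w * Z k w)%:E = (n%:R * (m * m))%:E.
Proof.
elim: n => [|n IH] nk.
  rewrite mul0r -(integral_cst_EFin 0).
  by apply: eq_integral => w _; rewrite /S big_ord0 mul0r.
under eq_integral do rewrite SSn mulrDl.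
rewrite integralD_EFin//.
- by rewrite IH 1?ltnW// EZZ ?ltn_eqF// -EFinD; congr EFin; rewrite -natr1; ring.
- by apply: measurable_funM => //; exact: mS.
- exact: measurable_funM.
- by move=> w; rewrite mulr_ge0//; exact: S0.
- by move=> w; rewrite mulr_ge0.
Qed.

Let ESS n : \int[P]_w (S n w * S n w)%:E =
  (n%:R * v + n%:R * (n%:R - 1) * (m * m))%:E.
Proof.
elim: n => [|n IH].
  rewrite !mul0r addr0 -(integral_cst_EFin 0).
  by apply: eq_integral => w _; rewrite /S big_ord0 mul0r.
have SE w : (S n.+1 w * S n.+1 w =
    S n w * S n w + (2 * (S n w * Z n w) + Z n w * Z n w))%R.
  by rewrite SSn; ring.
under eq_integral do rewrite SE.
have mSS : measurable_fun setT (fun w => S n w * S n w)%R.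
  exact: measurable_funM.
have mSZ : measurable_fun setT (fun w => S n w * Z n w)%R.
  exact: measurable_funM.
have mZZ : measurable_fun setT (fun w => Z n w * Z n w)%R.
  exact: measurable_funM.
have SZ0 w : (0 <= S n w * Z n w)%R by rewrite mulr_ge0.
have ZZ0 w : (0 <= Z n w * Z n w)%R by rewrite mulr_ge0.
rewrite integralD_EFin//; last 3 first.
- by apply: measurable_funD => //; exact: measurable_funM.
- by move=> w; rewrite mulr_ge0.
- by move=> w; rewrite addr_ge0// mulr_ge0.
rewrite integralD_EFin//; last 2 first.
- exact: measurable_funM.
- by move=> w; rewrite mulr_ge0.
rewrite integralZ_EFin// IH ESZ// EZ2 -EFinM -!EFinD; congr EFin.
by rewrite -natr1; ring.
Qed.

(** Chebyshev's inequality: with all covariances zero the variance is [n * (v - m * m)], which is at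
    most [n * v]. *)
Lemma second_moment_deviation n (a : R) : (0 < a)%R ->
  P [set w | (a <= `|(\sum_(i < n) Z i w)%R - n%:R * m|)%R] <=
  (n%:R * v / a ^+ 2)%:E.
Proof.
move=> a0; set c := (n%:R * m)%R.
have m0 : (0 <= m)%R by rewrite -lee_fin -(EZ 0); apply: integral_ge0 => w _; rewrite lee_fin.
have c0 : (0 <= c)%R by rewrite mulr_ge0.
have mD : measurable_fun setT (fun w => S n w - c)%R by exact: measurable_funB.
have mD2 : measurable_fun setT (fun w => (S n w - c) * (S n w - c))%R.
  exact: measurable_funM.
have D2 w : (0 <= (S n w - c) * (S n w - c))%R by rewrite -expr2 sqr_ge0.
(* The square is expanded with the cross term moved to the left, so that every integrand is
   nonnegative and additivity of the integral applies. The resulting equation forces the integral of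
   the square to be finite, and the cross term can then be cancelled. *)
have : \int[P]_w ((S n w - c) * (S n w - c) + 2 * c * S n w)%:E =
    \int[P]_w (S n w * S n w + c * c)%:E.
  by apply: eq_integral => w _; congr EFin; ring.
rewrite integralD_EFin//; last 2 first.
- exact: measurable_funM.
- by move=> w; rewrite !mulr_ge0.
rewrite integralD_EFin//; last 3 first.
- exact: measurable_funM.
- by move=> w; rewrite mulr_ge0.
- by move=> w; rewrite mulr_ge0.
rewrite integralZ_EFin ?mulr_ge0// ES ESS integral_cst_EFin -/c.
move=> E2.
have {}E2 : \int[P]_w ((S n w - c) * (S n w - c))%:E = (n%:R * (v - m * m))%:E.
  move: E2; set I := \int[P]_w _; case: I => [x [xE]| |] //.
  by congr EFin; apply: (addIr (2 * c * c)%R); rewrite xE /c; ring.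
set A := [set w | _].
have mA : measurable A.
  rewrite (_ : A = (fun w => `|S n w - c|%R) @^-1` `[a, +oo[%classic).
    rewrite -[X in measurable X]setTI.
    have mN : measurable_fun setT (fun w => `|S n w - c|%R).
      exact: measurableT_comp.
    exact: mN.
  by apply/seteqP; split=> w /=; rewrite in_itv/= andbT.
have : (a ^+ 2)%:E * P A <= \int[P]_w ((S n w - c) * (S n w - c))%:E.
  rewrite -[A]setIT -integral_indic// -integralZ_EFin ?sqr_ge0//.
  apply: ge0_le_integral => //.
  - by move=> w _; rewrite lee_fin mulr_ge0// sqr_ge0.
  - by apply/measurable_EFinP; exact: measurable_funM.
  - exact/measurable_EFinP.
  - move=> w _; rewrite lee_fin indicE; case: (boolP (w \in A)) => [|_].
      rewrite inE /A/= mulr1 => aw.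
      by rewrite -expr2 -[leRHS]real_normK ?num_real// lerXn2r// nnegrE ltW.
    by rewrite mulr0.
rewrite E2 -lee_pdivlMl ?exprn_gt0 ?mulr_gt0//; move/le_trans; apply.
rewrite -EFinM lee_fin mulrC ler_wpM2r ?invr_ge0 ?sqr_ge0//.
by rewrite ler_wpM2l// gerBl mulr_ge0.
Qed.

End second_moment.

(** * Independence and the Borel-Cantelli lemmas *)

Section probability_facts.
Context {d : measure_display} {Omega : measurableType d} {R : realType}.
Variable P : probability Omega R.

Lemma prE (A : set Omega) : measurable A -> P A = (fine (P A))%:E.
Proof. by move=> mA; rewrite fineK// fin_num_measure. Qed.

Lemma pr_ge0 (A : set Omega) : 0 <= fine (P A).
Proof. exact: fine_ge0. Qed.

Lemma le_pr (A B : set Omega) : measurable A -> measurable B -> A `<=` B ->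
  fine (P A) <= fine (P B).
Proof.
move=> mA mB AB; rewrite -lee_fin -!prE//.
by apply: le_measure => //; rewrite inE.
Qed.

Lemma pr_le1 (A : set Omega) : measurable A -> fine (P A) <= 1.
Proof. by move=> mA; rewrite -lee_fin -prE// probability_le1. Qed.

Lemma pr_setC (A : set Omega) : measurable A -> fine (P (~` A)) = 1 - fine (P A).
Proof.
move=> mA; have := probability_setC P mA.
by rewrite (prE mA) (prE (measurableC mA)) -EFinB => -[].
Qed.

Lemma measurable_exists_lt n (A : nat -> set Omega) :
  (forall i, measurable (A i)) ->
  measurable [set w | exists2 i, (i < n)%N & A i w].
Proof.
move=> mA; rewrite (_ : [set w | _] = \bigcup_(i in `I_n) A i)//.
exact: bigcup_measurable.
Qed.

Lemma pr_exists_lt n (A : nat -> set Omega) : (forall i, measurable (A i)) ->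
  fine (P [set w | exists2 i, (i < n)%N & A i w]) <= \sum_(i < n) fine (P (A i)).
Proof.
move=> mA; have mE := measurable_exists_lt n mA.
rewrite -lee_fin -prE// -sumEFin.
under eq_bigr do rewrite -prE//.
rewrite (_ : [set w | _] = \bigcup_(i in `I_n) A i)//.
by rewrite bigcup_mkord; exact: Boole_inequality.
Qed.

(** The sum starts at [N] because the estimates hold only for large indices; the shifted sequence
    [F (k + N)] has a finite series and the same limit superior. *)
Lemma borel_cantelli_first (F : nat -> set Omega) (N : nat) (C : R) :
  (forall n, measurable (F n)) ->
  (forall n, \sum_(N <= i < n) fine (P (F i)) <= C) ->
  {ae P, forall w, exists M, forall n, (M <= n)%N -> ~ F n w}.
Proof.
move=> mF FC.
have /lim_sup_set_cvg0 : forall k, measurable (F (k + N)%N) by [].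
move=> /(_ _ P) H.
exists (lim_sup_set (fun k => F (k + N)%N)); split.
- apply: bigcapT_measurable => n; exact: bigcup_measurable.
- apply: H; rewrite (nneseries_addn N (f := fun i => P (F i)))//.
  apply: (@le_lt_trans _ _ C%:E); last exact: ltry.
  apply: lime_le; first exact: is_cvg_nneseries.
  apply: nearW => n /=.
  by under eq_bigr do rewrite prE//; rewrite sumEFin lee_fin.
- move=> w /= /forallNP nM n _ /=.
  have /existsNP[k /not_implyP[nk /contrapT Fk]] := nM (n + N)%N.
  exists (k - N)%N => /=; first by rewrite leq_subRL ?(leq_trans (leq_addl n N))// addnC.
  by rewrite subnK// (leq_trans (leq_addl n N)).
Qed.

(* The product rule for finite intersections passes to complements one event
   at a time: P(A \ E) = P(A) - P(A /\ E). *)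
Lemma indep_complement (E : nat -> set Omega) :
  (forall n, measurable (E n)) ->
  (forall s : seq nat, uniq s ->
    fine (P [set w | forall j, j \in s -> E j w]) = \prod_(j <- s) fine (P (E j))) ->
  forall s t : seq nat, uniq (s ++ t) ->
    fine (P [set w | (forall j, j \in s -> E j w) /\ (forall j, j \in t -> ~ E j w)])
    = \prod_(j <- s) fine (P (E j)) * \prod_(j <- t) (1 - fine (P (E j))).
Proof.
move=> mE HE s t; elim: t s => [|k t IH] s.
  rewrite cats0 big_nil mulr1 => us; rewrite -HE//.
  by congr (fine (P _)); apply/seteqP; split=> w /=; [case|].
move=> ust; have /= /andP[ks ust'] : uniq (k :: (s ++ t)).
  by rewrite (perm_uniq (s2 := s ++ k :: t))// -cat1s perm_catCA.
have mJ (r : seq nat) : measurable [set w | forall j, j \in r -> E j w].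
  rewrite (_ : [set w | _] = \bigcap_(j in [set` r]) E j)//.
  by apply: bigcap_measurableType => j _.
have mK (r : seq nat) : measurable [set w | forall j, j \in r -> ~ E j w].
  rewrite (_ : [set w | _] = \bigcap_(j in [set` r]) ~` E j)//.
  by apply: bigcap_measurableType => j _; exact: measurableC.
have kst : uniq ((k :: s) ++ t) by rewrite /= ks.
set A := [set w | (forall j, j \in s -> E j w) /\ (forall j, j \in t -> ~ E j w)].
have mA : measurable A by exact: (measurableI _ _ (mJ s) (mK t)).
rewrite (_ : [set w | _] = A `\` E k); last first.
  apply/seteqP; split=> w /=.
    move=> [Es Et]; split; last by apply: Et; rewrite mem_head.
    by split=> // j jt; apply: Et; rewrite in_cons jt orbT.
  move=> [[Es Et] Ek]; split=> // j; rewrite in_cons => /predU1P[->//|].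
  exact: Et.
have := IH _ kst; rewrite big_cons.
rewrite (_ : [set w | _] = A `&` E k); last first.
  apply/seteqP; split=> w /=.
    move=> [Es Et]; split; last by apply: Es; rewrite mem_head.
    by split=> // j js; apply: Es; rewrite in_cons js orbT.
  move=> [[Es Et] Ek]; split=> // j; rewrite in_cons => /predU1P[->//|].
  exact: Es.
move=> PAE; rewrite big_cons measureD// ?ltey_eq ?fin_num_measure//.
rewrite fineB ?fin_num_measure//; last exact: measurableI.
rewrite -/A in IH; have := IH _ ust'; rewrite -/A => ->.
by rewrite PAE; ring.
Qed.


Lemma prod_one_sub_le_expR (p : nat -> R) (s : seq nat) :
  (forall j, p j <= 1) ->
  \prod_(j <- s) (1 - p j) <= expR (- \sum_(j <- s) p j).
Proof.
move=> p1; elim: s => [|j s IH]; first by rewrite !big_nil oppr0 expR0.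
rewrite !big_cons opprD expRD ler_pM ?subr_ge0 ?expR_ge1Dx//.
by apply: prodr_ge0 => i _; rewrite subr_ge0.
Qed.

Lemma borel_cantelli_second (E : nat -> set Omega) :
  (forall n, measurable (E n)) ->
  (forall s : seq nat, uniq s ->
    fine (P [set w | forall j, j \in s -> E j w]) = \prod_(j <- s) fine (P (E j))) ->
  (forall (N : nat) (C : R), exists n, C <= \sum_(N <= i < n) fine (P (E i))) ->
  {ae P, forall w, forall N, exists2 n, (N <= n)%N & E n w}.
Proof.
move=> mE HE Edvg; apply/ae_foralln => N.
pose K (s : seq nat) := [set w | forall j, j \in s -> ~ E j w].
have mK s : measurable (K s).
  rewrite (_ : K s = \bigcap_(j in [set` s]) ~` E j)//.
  by apply: bigcap_measurableType => j _; exact: measurableC.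
pose B := [set w | forall j, (N <= j)%N -> ~ E j w].
have mB : measurable B.
  rewrite (_ : B = \bigcap_(j in [set j | (N <= j)%N]) ~` E j)//.
  by apply: bigcap_measurableType => j _; exact: measurableC.
exists B; split => //; last first.
  by move=> w /= nE j Nj Ejw; apply: nE; exists j.
transitivity (fine (P B))%:E; first exact: prE.
congr EFin; apply/eqP; rewrite eq_le pr_ge0 andbT leNgt.
apply/negP => B0.
(* If [P B = p > 0], partial sums reaching [1 - ln p] would give [p <= expR (ln p - 1)], that is
   [p <= p / e]. *)
have [n En] := Edvg N (1 - ln (fine (P B))).
have : fine (P B) <= expR (- (1 - ln (fine (P B)))).
  apply: (@le_trans _ _ (expR (- \sum_(N <= i < n) fine (P (E i))))); last first.
    by rewrite ler_expR lerN2.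
  apply: (@le_trans _ _ (fine (P (K (index_iota N n))))).
    by apply: le_pr => // w Bw j; rewrite mem_index_iota => /andP[Nj _]; exact: Bw.
  have := @indep_complement E mE HE [::] (index_iota N n) (iota_uniq _ _).
  rewrite big_nil mul1r (_ : [set w | _] = K (index_iota N n)).
    by move=> ->; apply: prod_one_sub_le_expR => j; exact: pr_le1.
  by apply/seteqP; split=> w /=; [case|].
rewrite opprB expRD lnK ?posrE// -subr_le0.
rewrite -[X in X - _]mulr1 -mulrBr pmulr_rle0// subr_le0.
apply/negP; rewrite -ltNge expR_lt1; lra.
Qed.

(** [c] sends an index to the number of its block, which encodes disjointness of the blocks. The
    concatenation of distinct blocks is then free of repetitions, and both sides are the same
    product over its indices. *)
Lemma indep_blocks (A : nat -> set Omega) (b : nat -> seq nat) (c : nat -> nat) :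
  (forall s : seq nat, uniq s ->
    fine (P [set w | forall j, j \in s -> A j w]) = \prod_(j <- s) fine (P (A j))) ->
  (forall n, uniq (b n)) ->
  (forall n i, i \in b n -> c i = n) ->
  forall s : seq nat, uniq s ->
    fine (P [set w | forall n, n \in s -> forall i, i \in b n -> A i w]) =
    \prod_(n <- s) fine (P [set w | forall i, i \in b n -> A i w]).
Proof.
move=> HA ub bb s us.
have ubs : uniq (flatten (map b s)).
  elim: s us => //= n s IH /andP[ns us]; rewrite cat_uniq ub IH// andbT.
  apply/hasPn => i /flatten_mapP[m ms im]; apply/negP => /= ib.
  by move/negP : ns; apply; rewrite -(bb _ _ ib) (bb _ _ im).
rewrite (_ : [set w | _] = [set w | forall i, i \in flatten (map b s) -> A i w]).
  by rewrite HA// big_flatten big_map; apply: eq_bigr => n _; rewrite HA.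
apply/seteqP; split=> w /= H.
  by move=> i /flatten_mapP[n ns]; exact: H.
by move=> n ns i ib; apply: H; apply/flatten_mapP; exists n.
Qed.

Lemma mutually_independent_seq {d' : measure_display} {E : measurableType d'}
    (Y : nat -> {RV P >-> E}) (B : nat -> set E) (s : seq nat) :
  mutually_independent Y -> (forall k, measurable (B k)) -> uniq s ->
  fine (P [set w | forall j, j \in s -> B j (Y j w)]) =
  \prod_(j <- s) fine (P (Y j @^-1` B j)).
Proof.
move=> iY mB us.
have := iY [fset j in s]%fset B (fun k _ => mB k).
rewrite (_ : \bigcap_(k in _) _ = [set w | forall j, j \in s -> B j (Y j w)]).
  move=> ->.
  have mYB k : measurable (Y k @^-1` B k) by exact: measurable_funPTI.
  rewrite (eq_bigr (fun k => (fine (P (Y k @^-1` B k)))%:E)); last first.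
    by move=> k _; exact: prE.
  rewrite prodEFin/=; apply: perm_big; apply: uniq_perm (fset_uniq _) us _.
  by move=> j; rewrite inE.
by apply/seteqP; split=> w /= H j js; apply: H; move: js; rewrite /= inE.
Qed.

End probability_facts.

(* The potential is, up to sign, the tail of the series from rank J. *)
Lemma sum_min_sqr_dyadic (R : realType) (x : R) (J : nat) : 0 <= x ->
  \sum_(j < J) Num.min x (2 ^+ j) ^+ 2 / 2 ^+ j <= 4 * x.
Proof.
move=> x0.
pose psi i := if x <= 2 ^+ i then 2 * x ^+ 2 / 2 ^+ i else 4 * x - 2 * 2 ^+ i.
have psi0 i : 0 <= psi i.
  rewrite /psi; case: ifPn => [_|]; first by rewrite divr_ge0// mulr_ge0// sqr_ge0.
  rewrite -ltNge => ?; have : 0 <= 2 ^+ i :> R by rewrite exprn_ge0.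
  lra.
suff : \sum_(j < J) Num.min x (2 ^+ j) ^+ 2 / 2 ^+ j + psi J <= 4 * x.
  by apply: le_trans; rewrite lerDl.
elim: J => [|J IH].
  rewrite big_ord0 add0r /psi expr0; case: ifPn => [x1|_]; last by lra.
  rewrite divr1 expr2 mulrA -[leRHS]mulr1 ler_pM//; last lra.
  by rewrite mulr_ge0.
rewrite big_ord_recr/= -addrA; apply: le_trans IH; rewrite lerD2l.
have J0 : 0 < 2 ^+ J :> R by rewrite exprn_gt0.
have [u xE u0] : exists2 u, x = u * 2 ^+ J & 0 <= u.
  exists (x / 2 ^+ J); first by rewrite divfK// gt_eqF.
  by rewrite divr_ge0// ltW.
rewrite /psi (exprS 2 J).
move: J0 xE; set L := 2 ^+ J => J0 ->.
have le2 : (u * L <= 2 * L) = (u <= 2) by rewrite ler_pM2r.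
have le1 : (u * L <= L) = (u <= 1) by rewrite -{2}[L]mul1r ler_pM2r.
rewrite le1 le2 {le1 le2}.
have E1 : (u * L) ^+ 2 / L = u ^+ 2 * L by field; rewrite gt_eqF.
have E2 : 2 * (u * L) ^+ 2 / (2 * L) = u ^+ 2 * L by field; rewrite gt_eqF.
have E3 : 2 * (u * L) ^+ 2 / L = 2 * u ^+ 2 * L by field; rewrite gt_eqF.
have E4 : L ^+ 2 / L = L by field; rewrite gt_eqF.
have [u1|u1] := leP u 1.
  rewrite (min_idPl _); last by rewrite ler_piMl// ltW.
  by rewrite (le_trans u1) ?ler1n// E1 E2 E3; lra.
rewrite (min_idPr _); last by rewrite ler_peMl ?ltW.
rewrite E4; have [u2|u2] := leP u 2; last by rewrite mulrA; lra.
rewrite E2 -subr_ge0.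
rewrite (_ : _ - _ = (u - 1) * (3 - u) * L); last by ring.
by rewrite !mulr_ge0 ?subr_ge0 ?ltW//; lra.
Qed.

(** * Almost sure linear growth of sums of i.i.d. positive variables *)

Section renewal_growth.
Context {d : measure_display} {Omega : measurableType d} {R : realType}.
Variable P : probability Omega R.
Variable T : nat -> {RV P >-> R}.
Hypotheses (indT : mutually_independent T) (idT : identically_distributed T)
  (T_gt0 : forall k w, 0 < T k w)
  (ET : (\int[P]_w (T 0 w)%:E < +oo)%E).

(** The absolute value makes the truncation nonnegative on the whole line, as the integral lemmas
    require; on the positive values of [T] it is the plain minimum. *)
Let trunc (L x : R) : R := Num.min `|x| L.

Let trunc_ge0 L x : 0 <= L -> 0 <= trunc L x.
Proof. by move=> L0; rewrite /trunc le_min normr_ge0. Qed.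

Let trunc_le L x : trunc L x <= L.
Proof. by rewrite /trunc ge_min lexx orbT. Qed.

Let truncT L k w : trunc L (T k w) = Num.min (T k w) L.
Proof. by rewrite /trunc gtr0_norm. Qed.

Let measurable_trunc L : measurable_fun setT (trunc L).
Proof.
apply: (measurable_minr (f := fun x : R => `|x|) (g := cst L)) => //.
Qed.

Let integral_id (h : R -> R) k : measurable_fun setT h -> (forall x, 0 <= h x) ->
  (\int[P]_w (h (T k w))%:E = \int[P]_w (h (T 0 w))%:E)%E.
Proof.
move=> mh h0.
have mEh : measurable_fun setT (EFin \o h) by exact/measurable_EFinP.
have Eh0 y : (0 <= (EFin \o h) y)%E by rewrite lee_fin.
rewrite -[LHS](ge0_integral_distribution (T k) mEh Eh0).
rewrite -[RHS](ge0_integral_distribution (T 0) mEh Eh0).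
by apply: eq_measure_integral => A mA _; exact: idT.
Qed.

Let m L := fine (\int[P]_w (trunc L (T 0 w))%:E).
Let v L := fine (\int[P]_w (trunc L (T 0 w) * trunc L (T 0 w))%:E).

Let fin_integral (h : Omega -> R) (B : R) : measurable_fun setT h ->
  (forall w, 0 <= h w <= B) ->
  (\int[P]_w (h w)%:E = (fine (\int[P]_w (h w)%:E))%:E)%E.
Proof.
move=> mh hB; rewrite fineK// ge0_fin_numE; last first.
  by apply: integral_ge0 => w _; rewrite lee_fin; have /andP[] := hB w.
apply: (@le_lt_trans _ _ (\int[P]_w B%:E)%E).
  apply: ge0_le_integral => //.
  - by move=> w _; rewrite lee_fin; have /andP[] := hB w.
  - exact/measurable_EFinP.
  - by move=> w _; rewrite lee_fin; have /andP[] := hB w.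
by rewrite integral_cst_EFin ltry.
Qed.

Let mtruncT L k : measurable_fun setT (fun w => trunc L (T k w)).
Proof. exact: measurableT_comp. Qed.

Let measurable_dev L n a :
  measurable [set w | a <= `|\sum_(i < n) trunc L (T i w) - n%:R * m L|].
Proof.
have mD : measurable_fun setT
    (fun w => `|\sum_(i < n) trunc L (T i w) - n%:R * m L|).
  apply: measurableT_comp => //; apply: measurable_funB => //.
  exact: measurable_sum.
rewrite (_ : [set w | _] = (fun w => `|\sum_(i < n) trunc L (T i w) - n%:R * m L|)
  @^-1` `[a, +oo[%classic).
  by rewrite -[X in measurable X]setTI; exact: mD.
by apply/seteqP; split=> w /=; rewrite in_itv/= andbT.
Qed.

Let measurable_T_gt i L : measurable [set w | L < T i w].
Proof.
rewrite (_ : [set w | _] = T i @^-1` `]L, +oo[%classic).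
  exact: measurable_funPTI.
by apply/seteqP; split=> w /=; rewrite in_itv/= andbT.
Qed.

Let deviation L n a : 0 <= L -> 0 < a ->
  fine (P [set w | a <= `|\sum_(i < n) trunc L (T i w) - n%:R * m L|]) <=
  n%:R * v L / a ^+ 2.
Proof.
move=> L0 a0; rewrite -lee_fin -prE; last exact: measurable_dev.
have t0 x : 0 <= trunc L x by exact: trunc_ge0.
have mE : (\int[P]_w (trunc L (T 0 w))%:E = (m L)%:E)%E.
  by apply: (fin_integral (B := L)) => // w; rewrite t0 trunc_le.
apply: (second_moment_deviation (Z := fun i w => trunc L (T i w))) => //.
- by move=> i; rewrite (integral_id i (measurable_trunc L)).
- move=> i.
  rewrite (integral_id (h := fun x => trunc L x * trunc L x))//.
  + apply: (fin_integral (B := L * L)) => [|w].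
      exact: measurable_funM.
    by rewrite mulr_ge0// ler_pM// trunc_le.
  + exact: measurable_funM.
  + by move=> x; rewrite mulr_ge0.
- move=> i j ij; rewrite (indep_integralM (f := trunc L) (g := trunc L))//.
    by rewrite !(integral_id _ (measurable_trunc L))// mE.
  move=> A B mA mB.
  pose C k := if k == i then A else B.
  have mC k : measurable (C k) by rewrite /C; case: ifP.
  have := @mutually_independent_seq _ _ _ P _ _ T C [:: i; j] indT mC.
  rewrite /= inE ij => /(_ isT).
  rewrite !big_cons big_nil mulr1 /C eqxx eq_sym (negbTE ij) => E.
  rewrite (prE P (measurable_funPTI (T i) mA)) (prE P (measurable_funPTI (T j) mB)).
  rewrite -EFinM -E -prE; last first.
    rewrite (_ : [set w | _] = \bigcap_(k in [set` [:: i; j]]) T k @^-1` C k)//.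
    by apply: bigcap_measurableType => k _; exact: measurable_funPTI.
  congr (P _); apply/seteqP; split=> w /=.
    move=> [Aw Bw] k; rewrite !inE /C; case: eqP => [->//|_ /= /eqP -> //].
  move=> H; split; [have := H i|have := H j]; rewrite /C !inE eqxx ?orbT/=.
    exact.
  by rewrite eq_sym (negbTE ij); exact.
Qed.


Let alpha := fine (\int[P]_w (T 0 w)%:E).

Let alphaE : (\int[P]_w (T 0 w)%:E = alpha%:E)%E.
Proof.
rewrite /alpha fineK// ge0_fin_numE//.
by apply: integral_ge0 => w _; rewrite lee_fin ltW.
Qed.

Let mE L : 0 <= L -> (\int[P]_w (trunc L (T 0 w))%:E = (m L)%:E)%E.
Proof.
by move=> L0; apply: (fin_integral (B := L)) => // w; rewrite trunc_ge0 ?trunc_le.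
Qed.

Let vE L : 0 <= L ->
  (\int[P]_w (trunc L (T 0 w) * trunc L (T 0 w))%:E = (v L)%:E)%E.
Proof.
move=> L0; apply: (fin_integral (B := L * L)) => [|w].
  exact: measurable_funM.
by rewrite mulr_ge0 ?trunc_ge0// ler_pM ?trunc_ge0// trunc_le.
Qed.

Let m_le L : 0 <= L -> m L <= alpha.
Proof.
move=> L0; rewrite -lee_fin -mE// -alphaE; apply: ge0_le_integral => //.
- by move=> w _; rewrite lee_fin trunc_ge0.
- exact/measurable_EFinP.
- exact/measurable_EFinP.
- by move=> w _; rewrite lee_fin truncT ge_min lexx.
Qed.

(** The truncated variable equals [L] on this event. The tail is thus controlled by the same
    quantity as the variance, and one series serves for both. *)
Let tail_le L : 0 < L -> fine (P [set w | L < T 0 w]) <= v L / L ^+ 2.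
Proof.
move=> L0; set A := [set w | _].
have mA : measurable A by exact: measurable_T_gt.
rewrite ler_pdivlMr ?exprn_gt0// mulrC -lee_fin EFinM -prE// -(vE (ltW L0)).
rewrite -[A]setIT -integral_indic// -integralZ_EFin ?sqr_ge0//.
apply: ge0_le_integral => //.
- by move=> w _; rewrite lee_fin mulr_ge0// sqr_ge0.
- by apply/measurable_EFinP; exact: measurable_funM.
- by apply/measurable_EFinP; exact: measurable_funM.
- move=> w _; rewrite lee_fin indicE truncT; case: (boolP (w \in A)) => [|_].
    by rewrite inE /A/= mulr1 => /ltW Lw; rewrite (min_idPr Lw) expr2.
  by rewrite mulr0 mulr_ge0// le_min !ltW.
Qed.

(** Exchanging sum and integral reduces this to [sum_min_sqr_dyadic] applied pointwise to [T 0];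
    here the finite mean yields summability. *)
Let sum_v n : \sum_(j < n) v (2 ^+ j) / 2 ^+ j <= 4 * alpha.
Proof.
have e0 j : 0 <= 2 ^+ j :> R by rewrite exprn_ge0.
rewrite -lee_fin -sumEFin.
rewrite (eq_bigr (fun j : 'I_n => \int[P]_w
  ((2 ^+ j)^-1 * (trunc (2 ^+ j) (T 0 w) * trunc (2 ^+ j) (T 0 w)))%:E)%E); last first.
  move=> j _; rewrite integralZ_EFin ?invr_ge0// ?vE//.
  - by rewrite -EFinM mulrC.
  - exact: measurable_funM.
  - by move=> w; rewrite mulr_ge0 ?trunc_ge0.
rewrite -ge0_integral_sum//; last 2 first.
- move=> j; apply/measurable_EFinP; apply: measurable_funM => //.
  exact: measurable_funM.
- by move=> j w _; rewrite lee_fin !mulr_ge0 ?trunc_ge0 ?invr_ge0.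
rewrite EFinM -alphaE -integralZ_EFin//; last by move=> w; exact: ltW.
apply: ge0_le_integral => //.
- by move=> w _; apply: sume_ge0 => j _; rewrite lee_fin !mulr_ge0 ?trunc_ge0 ?invr_ge0.
- apply: emeasurable_sum => j; apply/measurable_EFinP; apply: measurable_funM => //.
  exact: measurable_funM.
- by apply/measurable_EFinP; exact: measurable_funM.
- move=> w _; rewrite sumEFin lee_fin.
  rewrite (le_trans _ (sum_min_sqr_dyadic n (ltW (T_gt0 0 w))))//.
  by apply: ler_sum => j _; rewrite truncT mulrC expr2.
Qed.

Let epoch_le (w : Omega) n k : (n <= k)%N ->
  \sum_(i < n) T i w <= \sum_(i < k) T i w.
Proof.
move=> nk; rewrite -(subnK nk) addnC big_split_ord/= lerDl.
by apply: sumr_ge0 => i _; rewrite ltW.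
Qed.

(** Truncate the first [2 ^ j] variables at [2 ^+ j]. That one of them is changed, and that the
    truncated sum deviates by [2 ^+ j] from its mean, both have probability at most
    [v (2 ^+ j) / 2 ^+ j], which is summable. The deviation is the [1] in [alpha + 1]. *)
Let dyadic_upper : {ae P, forall w, exists N, forall j, (N <= j)%N ->
  \sum_(i < 2 ^ j) T i w <= (alpha + 1) * 2 ^+ j}.
Proof.
pose F j := [set w | 2 ^+ j <=
  `|\sum_(i < 2 ^ j) trunc (2 ^+ j) (T i w) - (2 ^ j)%:R * m (2 ^+ j)|].
pose D j := [set w | exists2 i, (i < 2 ^ j)%N & 2 ^+ j < T i w].
have p0 j : 0 < 2 ^+ j :> R by rewrite exprn_gt0.
have mF j : measurable (F j) by exact: measurable_dev.
have mA j i : measurable [set w | 2 ^+ j < T i w] by exact: measurable_T_gt.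
have mD j : measurable (D j) by exact: (measurable_exists_lt (2 ^ j) (mA j)).
have BF : forall n, \sum_(0 <= j < n) fine (P (F j)) <= 4 * alpha.
  move=> n; rewrite big_mkord (le_trans _ (sum_v n))//; apply: ler_sum => j _.
  rewrite (le_trans (deviation _ (ltW (p0 j)) (p0 j)))// natrX.
  by rewrite le_eqVlt; apply/orP; left; apply/eqP; field; rewrite gt_eqF.
have BD : forall n, \sum_(0 <= j < n) fine (P (D j)) <= 4 * alpha.
  move=> n; rewrite big_mkord (le_trans _ (sum_v n))//; apply: ler_sum => j _.
  rewrite (le_trans (pr_exists_lt P (2 ^ j) (mA j)))//.
  rewrite (eq_bigr (fun=> fine (P [set w | 2 ^+ j < T 0 w]))); last first.
    move=> i _; congr fine.
    rewrite (_ : [set w | 2 ^+ j < T i w] = T i @^-1` `]2 ^+ j, +oo[%classic).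
      rewrite (_ : [set w | 2 ^+ j < T 0 w] = T 0 @^-1` `]2 ^+ j, +oo[%classic).
        exact: idT.
      by apply/seteqP; split=> w /=; rewrite in_itv/= andbT.
    by apply/seteqP; split=> w /=; rewrite in_itv/= andbT.
  rewrite sumr_const card_ord -[leLHS]mulr_natl natrX.
  rewrite (le_trans (ler_wpM2l (ltW (p0 j)) (tail_le (p0 j))))//.
  by rewrite le_eqVlt; apply/orP; left; apply/eqP; field; rewrite gt_eqF.
have := borel_cantelli_first mF BF; have := borel_cantelli_first mD BD.
apply: filterS2 => w [N1 H1] [N2 H2]; exists (maxn N1 N2) => j.
rewrite geq_max => /andP[/H1 nD /H2 nF].
have nT i : (i < 2 ^ j)%N -> T i w <= 2 ^+ j.
  by move=> ij; rewrite leNgt; apply/negP => jT; apply: nD; exists i.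
rewrite (eq_bigr (fun i : 'I__ => trunc (2 ^+ j) (T i w))); last first.
  by move=> i _; rewrite truncT; apply/esym/min_idPl; exact: nT.
move/negP : nF; rewrite -ltNge => /ltW; rewrite ler_norml => /andP[_].
rewrite lerBlDl natrX => /le_trans; apply.
rewrite mulrDl mul1r lerD2r mulrC ler_wpM2r// ?m_le// ltW//.
Qed.

Let m1_gt0 : 0 < m 1.
Proof.
rewrite -lte_fin -mE//; apply: integral_gt0 => // w.
by rewrite truncT lt_min T_gt0/=.
Qed.

(** For a lower bound the fixed truncation at 1 is enough, since its mean is positive. The
    probability of falling short by half the mean is at most [c / 2 ^+ j], with [c] the constant
    below. *)
Let dyadic_lower : {ae P, forall w, exists N, forall j, (N <= j)%N ->
  m 1 / 2 * 2 ^+ j <= \sum_(i < 2 ^ j) T i w}.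
Proof.
pose a (j : nat) := m 1 / 2 * 2 ^+ j.
have p0 j : 0 < 2 ^+ j :> R by rewrite exprn_gt0.
have a0 j : 0 < a j by rewrite /a mulr_gt0// divr_gt0// m1_gt0.
pose F j := [set w | a j <=
  `|\sum_(i < 2 ^ j) trunc 1 (T i w) - (2 ^ j)%:R * m 1|].
have mF j : measurable (F j) by exact: measurable_dev.
pose c := 4 * v 1 / m 1 ^+ 2.
have c0 : 0 <= c.
  rewrite /c divr_ge0 ?sqr_ge0// mulr_ge0//; apply: fine_ge0.
  by apply: integral_ge0 => w _; rewrite lee_fin mulr_ge0 ?trunc_ge0.
have c20 : 0 <= 2 * c by apply: mulr_ge0 c0.
have BF : forall n, \sum_(0 <= j < n) fine (P (F j)) <= 2 * c.
  suff H n : \sum_(0 <= j < n) fine (P (F j)) <= 2 * c - 2 * c / 2 ^+ n.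
    by move=> n; rewrite (le_trans (H n))// gerBl divr_ge0// exprn_ge0.
  elim: n => [|n IH]; first by rewrite big_geq// expr0 divr1 subrr.
  rewrite big_nat_recr//= (le_trans (lerD IH (deviation _ _ _)))//.
  rewrite le_eqVlt; apply/orP; left; apply/eqP.
  rewrite natrX /a /c (exprS 2 n).
  by field; rewrite !gt_eqF// m1_gt0.
have := borel_cantelli_first mF BF.
apply: filterS => w [N H]; exists N => j /H/negP; rewrite -ltNge natrX => /ltW.
rewrite ler_norml /a => /andP[+ _] => Sm.
have : \sum_(i < 2 ^ j) trunc 1 (T i w) <= \sum_(i < 2 ^ j) T i w.
  by apply: ler_sum => i _; rewrite truncT ge_min lexx.
lra.
Qed.

(** The sums increase with [k], so the dyadic bounds extend to all [k] at the price of a factor 2 in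
    each constant; such factors move the logarithm of an epoch only by a bounded amount. *)
Lemma renewal_linear_growth : exists c C : R, [/\ 0 < c, 0 < C &
  {ae P, forall w, exists N, forall k, (N <= k)%N ->
    c * k%:R <= \sum_(i < k) T i w <= C * k%:R}].
Proof.
have alpha0 : 0 <= alpha.
  by apply: fine_ge0; apply: integral_ge0 => w _; rewrite lee_fin ltW.
have m0 := m1_gt0.
exists (m 1 / 4), (2 * (alpha + 1)); split; [lra|lra|].
move: dyadic_upper dyadic_lower; apply: filterS2 => w [N1 H1] [N2 H2].
exists (2 ^ maxn N1 N2)%N => k Nk.
have k0 : (0 < k)%N by rewrite (leq_trans _ Nk)// expn_gt0.
have /andP[jk kj] := trunc_log_bounds (isT : (1 < 2)%N) k0.
have Nj : (maxn N1 N2 <= trunc_log 2 k)%N by exact: trunc_log_max.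
move: jk kj Nj; set j := trunc_log 2 k => jk kj.
rewrite geq_max => /andP[N1j N2j].
have kR : 2 ^+ j <= k%:R :> R by rewrite -natrX ler_nat.
have kR2 : k%:R <= 2 * 2 ^+ j :> R by rewrite -exprS -natrX ler_nat ltnW.
apply/andP; split.
  apply: (le_trans _ (epoch_le w jk)); apply: (le_trans _ (H2 _ N2j)).
  have : m 1 / 4 * k%:R <= m 1 / 4 * (2 * 2 ^+ j) by rewrite ler_wpM2l//; lra.
  lra.
apply: (le_trans (epoch_le w (ltnW kj))).
apply: (le_trans (H1 _ (leqW N1j))); rewrite exprS.
have : (alpha + 1) * 2 ^+ j <= (alpha + 1) * k%:R by rewrite ler_wpM2l//; lra.
lra.
Qed.

End renewal_growth.

(** * Levels reached by the maxima of the periods *)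

Lemma sum_pseries_le (R : realType) (e : R) (n : nat) : 0 < e ->
  \sum_(1 <= i < n) expR (- (1 + e) * ln i%:R) <= 1 + e^-1.
Proof.
move=> e0.
case: n => [|n]; first by rewrite big_geq// addr_ge0// invr_ge0 ltW.
(* The right side is 1 plus the integral of [u ^ (- 1 - e)] from 1 to [k + 1]; keeping the
   subtracted term makes the induction close. *)
suff H k : \sum_(1 <= i < k.+2) expR (- (1 + e) * ln i%:R) <=
    1 + e^-1 - e^-1 * expR (- e * ln k.+1%:R).
  case: n => [|n]; first by rewrite big_geq// addr_ge0// invr_ge0 ltW.
  by rewrite (le_trans (H n))// gerBl mulr_ge0 ?expR_ge0// invr_ge0 ltW.
elim: k => [|k IH].
  by rewrite big_nat1 ln1 !mulr0 expR0 mulr1 addrK.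
rewrite big_nat_recr//= (le_trans (lerD IH (lexx _)))//.
set u : R := k.+1%:R; set u' : R := k.+2%:R.
have u0 : 0 < u by rewrite ltr0n.
have u'0 : 0 < u' by rewrite ltr0n.
have uu' : u' = u + 1 by rewrite /u /u' -natr1.
have lnu : u'^-1 <= ln u' - ln u.
  rewrite -[leRHS]opprB -ln_div ?posrE//.
  rewrite (_ : u / u' = 1 + - u'^-1); last by rewrite uu'; field; lra.
  rewrite lerNr; apply: le_ln1Dx; rewrite ltrN2 invf_lt1//.
  by rewrite uu' ltrDr.
have expE : expR (- (1 + e) * ln u') = expR (- e * ln u') / u'.
  rewrite (_ : - (1 + e) * _ = - e * ln u' - ln u'); last by ring.
  by rewrite expRD expRN lnK.
have expu : expR (- e * ln u') * (1 + e / u') <= expR (- e * ln u).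
  rewrite (_ : - e * ln u = - e * ln u' + e * (ln u' - ln u)); last by ring.
  rewrite expRD ler_wpM2l ?expR_ge0// (le_trans _ (expR_ge1Dx _))// lerD2l.
  by rewrite ler_wpM2l// ltW.
rewrite expE -subr_ge0; set a := expR _ in expu *; set b := expR _ in expu *.
rewrite (_ : _ - _ = e^-1 * (b - a * (1 + e / u'))); last by field; lra.
by apply: mulr_ge0; rewrite ?subr_ge0// invr_ge0 ltW.
Qed.

(** The left side telescopes, and each increment of [ln (ln i)] is at most [1 / (i * ln i)] by two
    uses of [ln (1 + u) <= u]. *)
Lemma sum_inv_nlnn_ge (R : realType) (N n : nat) : (1 < N)%N -> (N <= n)%N ->
  ln (ln n%:R) - ln (ln N%:R) <=
  \sum_(N <= i < n) expR (- ln i%:R - ln (ln i%:R)) :> R.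
Proof.
move=> N1 Nn; rewrite -(telescope_sumr (fun i => ln (ln i%:R) : R) Nn).
apply: ler_sum_nat => i /andP[Ni _].
have i1 : 1 < i%:R :> R by rewrite ltr1n (leq_trans N1).
have i0 : 0 < i%:R :> R by rewrite (lt_trans ltr01).
have li0 : 0 < ln i%:R :> R by rewrite ln_gt0.
have li1 : 0 < ln i.+1%:R :> R by rewrite ln_gt0// ltr1n ltnS (leq_trans _ Ni)// ltnW.
rewrite -ln_div ?posrE// expRB expRN !lnK ?posrE//.
have -> : ln i.+1%:R / ln i%:R = 1 + (ln i.+1%:R - ln i%:R) / ln i%:R :> R.
  by field; rewrite gt_eqF.
have d0 : 0 <= ln i.+1%:R - ln i%:R :> R.
  by rewrite subr_ge0 ler_ln ?posrE ?ltr0Sn// ler_nat.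
apply: le_trans (le_ln1Dx _) _.
  by rewrite (lt_le_trans (ltrN10 _))// divr_ge0// ltW.
rewrite ler_wpM2r ?invr_ge0 ?(ltW li0)// -ln_div ?posrE//.
rewrite -natr1 mulrDl divff ?gt_eqF// mul1r; apply: le_ln1Dx.
by rewrite (lt_trans (ltrN10 _))// invr_gt0.
Qed.

Lemma sum_harmonic_ge (R : realType) (N n : nat) : (0 < N)%N -> (N <= n)%N ->
  ln n%:R - ln N%:R <= \sum_(N <= i < n) expR (- ln i%:R) :> R.
Proof.
move=> N0 Nn; rewrite -(telescope_sumr (fun i => ln i%:R : R) Nn).
apply: ler_sum_nat => i /andP[Ni _].
have i0 : 0 < i%:R :> R by rewrite ltr0n (leq_trans N0).
rewrite -ln_div ?posrE// expRN lnK ?posrE//.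
rewrite -natr1 mulrDl divff ?gt_eqF// mul1r; apply: le_ln1Dx.
by rewrite (lt_trans (ltrN10 _))// invr_gt0.
Qed.

Lemma expR_le_one_sub (R : realType) (p : R) : 0 <= p <= 1 / 2 -> expR (- 2 * p) <= 1 - p.
Proof.
move=> /andP[p0 p1]; rewrite mulNr expRN.
have : 1 + 2 * p <= expR (2 * p) := expR_ge1Dx _.
move=> H; apply: (@le_trans _ _ (1 + 2 * p)^-1).
  by rewrite lef_pV2 ?posrE ?expR_gt0//; lra.
rewrite -[leLHS]mul1r ler_pdivrMr; last by lra.
rewrite -subr_ge0 (_ : _ - _ = p * (1 - 2 * p)); last by ring.
by rewrite mulr_ge0//; lra.
Qed.

Lemma cvg_add_littleo_pinfty (R : realType) (l : R -> R) (y : R) :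
  l x @[x --> +oo] --> +oo ->
  (forall e, 0 < e -> \forall x \near +oo, l x <= e * x) ->
  x + y * l x @[x --> +oo] --> (+oo : set_system R).
Proof.
move=> ly lo; apply/cvgryPge => A; near=> x.
have x0 : 0 < x by near: x; apply: nbhs_pinfty_gt; exact: num_real.
have l0 : 0 <= l x by near: x; move/cvgryPge : ly; apply.
have y0 : 0 < 2 * (`|y| + 1) by rewrite mulr_gt0// ltr_wpDl.
have lx : l x <= (2 * (`|y| + 1))^-1 * x by near: x; apply: lo; rewrite invr_gt0.
have Ax : 2 * A <= x by near: x; apply: nbhs_pinfty_ge; exact: num_real.
have : `|y * l x| <= x / 2.
  rewrite normrM (ger0_norm l0).
  have : (`|y| + 1) * l x <= x / 2.
    rewrite -ler_pdivlMl ?ltr_wpDl//; apply: le_trans lx _.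
    by rewrite invfM [2^-1 * _]mulrC -mulrA [2^-1 * _]mulrC.
  by apply: le_trans; rewrite ler_wpM2r// lerDl.
rewrite ler_norml => /andP[? _]; lra.
Unshelve. all: by end_near.
Qed.

Lemma borel_cantelli_pseries {d : measure_display} {Omega : measurableType d}
    {R : realType} (P : probability Omega R) (F : nat -> set Omega) (K e : R) :
  0 < e -> (forall n, measurable (F n)) ->
  (\forall n \near \oo, fine (P (F n)) <= K * expR (- (1 + e) * ln n%:R)) ->
  {ae P, forall w, exists N, forall n, (N <= n)%N -> ~ F n w}.
Proof.
move=> e0 mF [N _ FK].
have K0 : 0 <= K.
  have := FK N (leqnn _); move/(le_trans (pr_ge0 P (F N))).
  by rewrite pmulr_lge0// expR_gt0.
(* Starting at [N.+1] keeps the index at least 1, where the bound on the series begins. *)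
apply: (@borel_cantelli_first _ _ _ P F N.+1 (K * (1 + e^-1)) mF) => n.
apply: (@le_trans _ _ (\sum_(N.+1 <= i < n) K * expR (- (1 + e) * ln i%:R))).
  by apply: ler_sum_nat => i /andP[Ni _]; apply: FK; exact: ltnW.
rewrite -mulr_sumr ler_wpM2l//.
apply: le_trans (sum_pseries_le n e0).
have [Nn|nN] := leqP N.+1 n; last first.
  rewrite big_geq ?(ltnW nN)//; apply: sumr_ge0 => i _; exact: expR_ge0.
rewrite [leRHS](big_cat_nat (n := N.+1))//= lerDr.
by apply: sumr_ge0 => i _; exact: expR_ge0.
Qed.

Lemma expR_nat_ln2 (R : realType) (n : nat) : expR (n%:R * ln 2) = (2 ^ n)%:R :> R.
Proof. by rewrite expRM_natl lnK ?posrE// natrX. Qed.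

Lemma ln2_gt0 (R : realType) : 0 < ln 2 :> R.
Proof. by rewrite ln_gt0// ltr1n. Qed.

Lemma cvg_natr_ln2 (R : realType) : n%:R * ln 2 @[n --> \oo] --> (+oo : set_system R).
Proof.
apply/cvgryPge => A; near=> n.
rewrite -ler_pdivrMr ?ln2_gt0//; near: n; exact: nbhs_infty_ger.
Unshelve. all: by end_near.
Qed.

Lemma near_natr_pinfty (R : realType) (Q : R -> Prop) :
  (\forall x \near +oo, Q x) -> \forall n \near \oo, Q n%:R.
Proof. exact: cvgr_idn. Qed.

Section record_levels.
Context {d d' : measure_display} {Omega : measurableType d}
  {E : measurableType d'} {R : realType}.
Variables (P : probability Omega R) (Y : nat -> {RV P >-> E}) (phi : E -> \bar R).
Hypotheses (indY : mutually_independent Y) (idY : identically_distributed Y)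
  (mphi : forall v : R, measurable [set p | (v%:E < phi p)%E]).
Variables (g : R -> R) (C : R).

Let q v := fine (P [set w | (v%:E < phi (Y 0 w))%E]).

Hypotheses
  (tail_up : \forall x \near +oo, q (g x + 1) <= expR (C - x))
  (tail_lo : \forall x \near +oo, expR (- C - x) <= q (g x - 1)).

Let G v k := [set w | (v%:E < phi (Y k w))%E].

Let mG v k : measurable (G v k).
Proof. exact: (measurable_funPTI (Y k) (mphi v)). Qed.

Let prG v k : fine (P (G v k)) = q v.
Proof. by congr fine; exact: (idY k (mphi v)). Qed.

Let q_ge0 v : 0 <= q v. Proof. exact: pr_ge0. Qed.

Let q_le1 v : q v <= 1. Proof. exact: (pr_le1 P (mG v 0)). Qed.

Let pr_all_gt (u : nat -> R) (s : seq nat) : uniq s ->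
  fine (P [set w | forall j, j \in s -> G (u j) j w]) = \prod_(j <- s) q (u j).
Proof.
move=> us.
rewrite (mutually_independent_seq (B := fun j => [set p | ((u j)%:E < phi p)%E]))//.
by apply: eq_bigr => j _; exact: prG.
Qed.

Let pr_all_le (u : nat -> R) (s : seq nat) : uniq s ->
  fine (P [set w | forall j, j \in s -> ~ G (u j) j w]) =
  \prod_(j <- s) (1 - q (u j)).
Proof.
move=> us; have mB j : measurable (~` [set p | ((u j)%:E < phi p)%E]).
  exact: measurableC.
rewrite (mutually_independent_seq indY mB us).
by apply: eq_bigr => j _; rewrite -(prG (u j) j) -pr_setC.
Qed.

(** This is the logarithm of the dyadic index [2 ^ n]. *)
Let x (n : nat) : R := n%:R * ln 2.

(** In the union bound the factor [2 ^ n = expR (x n)] cancels the leading part of the tail, leaving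
    a constant times [n ^ (- 1 - e)], which is summable. *)
Lemma dyadic_max_upper (e : R) : 0 < e ->
  {ae P, forall w, exists N, forall n, (N <= n)%N -> forall i, (i < 2 ^ n)%N ->
    (phi (Y i w) <= (g (x n + (1 + e) * ln (x n)) + 1)%:E)%E}.
Proof.
move=> e0; pose z n := g (x n + (1 + e) * ln (x n)) + 1.
pose F n := [set w | exists2 i, (i < 2 ^ n)%N & G (z n) i w].
have mF n : measurable (F n) by exact: (measurable_exists_lt (2 ^ n) (mG (z n))).
have : \forall n \near \oo, fine (P (F n)) <=
    expR (C - (1 + e) * ln (ln 2)) * expR (- (1 + e) * ln n%:R).
  have tn := cvg_comp _ _ (@cvg_natr_ln2 R)
    (cvg_add_littleo_pinfty (1 + e) (@cvg_ln_pinfty R) (@littleo_ln R)) _ tail_up.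
  near=> n.
  have n0 : 0 < n%:R :> R by rewrite ltr0n; near: n; exact: nbhs_infty_gt.
  rewrite (le_trans (pr_exists_lt P (2 ^ n) (mG (z n))))//.
  rewrite (eq_bigr (fun=> q (z n))) => [|i _]; last exact: prG.
  rewrite sumr_const card_ord -[leLHS]mulr_natl -expR_nat_ln2.
  apply: (@le_trans _ _ (expR (n%:R * ln 2) * expR (C - (x n + (1 + e) * ln (x n))))).
    by rewrite ler_wpM2l ?expR_ge0//; near: n; exact: tn.
  rewrite -!expRD ler_expR /x lnM ?posrE ?ln2_gt0//.
  by rewrite le_eqVlt; apply/orP; left; apply/eqP; ring.
move/(borel_cantelli_pseries e0 mF); apply: filterS => w [N FN].
exists N => n /FN nF i i2n; rewrite leNgt; apply/negP => Gi.
by apply: nF; exists i.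
Unshelve. all: by end_near.
Qed.

(** Single periods give independent events at once. Their probabilities are at least
    [expR (- C) / (i * ln i)], whose series diverges, and one large period already lifts the running
    maximum. *)
Lemma individual_records :
  {ae P, forall w, forall N, exists2 i, (N <= i)%N &
    ((g (ln i%:R + ln (ln i%:R)) - 1)%:E < phi (Y i w))%E}.
Proof.
pose z i : R := g (ln i%:R + ln (ln i%:R)) - 1.
apply: (@borel_cantelli_second _ _ _ P (fun i => G (z i) i)) => //.
  move=> s us; rewrite pr_all_gt//.
  by apply: eq_bigr => j _; rewrite prG.
move=> N0 B.
have := near_natr_pinfty (cvg_comp _ _ (@cvg_ln_pinfty R)
  (cvg_add_littleo_pinfty 1 (@cvg_ln_pinfty R) (@littleo_ln R)) _ tail_lo).
move=> [N1 _ HN]; pose N := maxn 2 (maxn N0 N1).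
have [n Bn] : exists2 n, (N <= n)%N &
    expR C * B + ln (ln N%:R) <= ln (ln n%:R).
  have lly : \forall x \near +oo, expR C * B + ln (ln N%:R) <= ln (ln x).
    by move/cvgryPge : (@cvg_lnln_pinfty R); exact.
  have [M _ HM] := near_natr_pinfty lly.
  by exists (maxn N M); [exact: leq_maxl|apply: HM; exact: leq_maxr].
have N0N : (N0 <= N)%N by rewrite !leq_max leqnn orbT.
exists n; rewrite (big_cat_nat N0N Bn)/=.
rewrite -[leLHS]add0r lerD//; first by apply: sumr_ge0 => i _; exact: pr_ge0.
have N1' : (1 < N)%N by rewrite leq_max leqnn.
apply: (@le_trans _ _ (expR (- C) *
    \sum_(N <= i < n) expR (- ln i%:R - ln (ln i%:R)))).
  rewrite expRN ler_pdivlMl ?expR_gt0//.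
  by apply: le_trans (sum_inv_nlnn_ge R N1' Bn); rewrite lerBrDr.
rewrite mulr_sumr; apply: ler_sum_nat => i /andP[Ni _].
rewrite prG -expRD -opprD.
have N1i : (N1 <= i)%N by rewrite (leq_trans _ Ni)// !leq_max leqnn !orbT.
have := HN i N1i; rewrite /= mul1r /z.
by rewrite opprD addrA.
Qed.


(** All [2 ^ n] maxima stay below the level with probability at most [expR (- 2 ^ n * q)], and at
    this level [2 ^ n * q] is at least [2 * ln n], which gives a bound [n ^ (- 2)]. *)
Lemma dyadic_max_lower (e : R) : 0 < e ->
  {ae P, forall w, exists N, forall n, (N <= n)%N -> exists2 i, (i < 2 ^ n)%N &
    ((g (x n - (1 + e) * ln (ln (x n))) - 1)%:E < phi (Y i w))%E}.
Proof.
move=> e0; pose z n := g (x n - (1 + e) * ln (ln (x n))) - 1.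
pose F n := [set w | forall i, i \in index_iota 0 (2 ^ n) -> ~ G (z n) i w].
have mF n : measurable (F n).
  rewrite (_ : F n = \bigcap_(i in [set` index_iota 0 (2 ^ n)]) ~` G (z n) i)//.
  by apply: bigcap_measurableType => i _; exact: measurableC.
have : \forall n \near \oo, fine (P (F n)) <= 1 * expR (- (1 + 1) * ln n%:R).
  have tn := cvg_comp _ _ (@cvg_natr_ln2 R) (cvg_add_littleo_pinfty (- (1 + e))
    (@cvg_lnln_pinfty R) (@littleo_lnln R)) _ tail_lo.
  have llx := cvg_comp _ _ (@cvg_natr_ln2 R) (@cvg_lnln_pinfty R).
  near=> n.
  have n0 : 0 < n%:R :> R by rewrite ltr0n; near: n; exact: nbhs_infty_gt.
  have tz : expR (- C - (x n - (1 + e) * ln (ln (x n)))) <= q (z n).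
    by rewrite /z -mulNr; near: n; exact: tn.
  (* Beyond this threshold the surplus [expR (e * ln (ln (x n)) - C)] is at least 4, so
     [2 ^ n * q >= 4 * ln (x n)]. As [ln (x n) = ln n + ln (ln 2)], half of [4 * ln n] absorbs the
     negative constant and [2 * ln n] remains. *)
  have lln : (C + ln 4) / e <= ln (ln (x n)).
    by near: n; move/cvgryPge : llx; exact.
  have ln2n : - 2 * ln (ln 2) <= ln n%:R :> R.
    by near: n; move/cvgryPge : (cvg_comp _ _ (@cvgr_idn R) (@cvg_ln_pinfty R)); exact.
  have ln0 : 0 <= ln n%:R :> R.
    by near: n; move/cvgryPge : (cvg_comp _ _ (@cvgr_idn R) (@cvg_ln_pinfty R)); exact.
  have lx0 : 0 < ln (x n).
    by near: n; move/cvgryPgt : (cvg_comp _ _ (@cvg_natr_ln2 R) (@cvg_ln_pinfty R)); exact.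
  rewrite pr_all_le ?iota_uniq//.
  rewrite (le_trans (prod_one_sub_le_expR _ (fun=> q_le1 _)))//.
  rewrite mul1r ler_expR mulNr lerN2 sumr_const_nat subn0 -[leRHS]mulr_natl.
  apply: (@le_trans _ _ ((2 ^ n)%:R * expR (- C - (x n - (1 + e) * ln (ln (x n)))))).
    2: by rewrite ler_wpM2l.
  rewrite -expR_nat_ln2 -expRD -/(x n).
  rewrite (_ : x n + _ = ln (ln (x n)) + (e * ln (ln (x n)) - C)); last by ring.
  rewrite expRD lnK ?posrE//.
  have e4 : 4 <= expR (e * ln (ln (x n)) - C).
    rewrite -[leLHS]lnK ?posrE// ler_expR lerBrDl mulrC -ler_pdivrMr//.
  have lxE : ln (x n) = ln n%:R + ln (ln 2) by rewrite /x lnM ?posrE ?ln2_gt0.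
  have : ln (x n) * 4 <= ln (x n) * expR (e * ln (ln (x n)) - C).
    by rewrite ler_wpM2l// ltW.
  by apply: le_trans; rewrite lxE; lra.
move/(borel_cantelli_pseries ltr01 mF); apply: filterS => w [N FN].
exists N => n /FN nF; apply: contrapT => nG; apply: nF => i.
by rewrite mem_index_iota => /andP[_ i2n] Gi; apply: nG; exists i.
Unshelve. all: by end_near.
Qed.

(** The indices below [2 ^ (n ^ 2)] split into the initial segment up to [2 ^ (n.-1 ^ 2)] and the
    block [b n]. By the first Borel-Cantelli lemma the initial segments eventually stay below the
    levels [z n]; by the second one the independent blocks do so infinitely often. Both hold
    together for infinitely many [n]. *)
Lemma sparse_max_upper (e : R) : 0 < e -> e < 1 ->
  {ae P, forall w, forall N, exists2 n, (N <= n)%N &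
    forall i, (i < 2 ^ (n ^ 2))%N ->
    (phi (Y i w) <=
      (g (x (n ^ 2) - (1 - e) * ln (ln (x (n ^ 2)))) + 1)%:E)%E}.
Proof.
move=> e0 e1; pose X n := x (n ^ 2).
pose z n := g (X n - (1 - e) * ln (ln (X n))) + 1.
have sqy : (n ^ 2)%N @[n --> \oo] --> \oo.
  apply/cvgnyPge => A; near=> n.
  rewrite (@leq_trans n)//; first by near: n; exact: nbhs_infty_ge.
  by rewrite -mulnn; clear; case: n => // n; rewrite leq_pmulr.
have Xy : X n @[n --> \oo] --> +oo := cvg_comp _ _ sqy (@cvg_natr_ln2 R).
(* In order, the bounds allow [1 - q] to be replaced by [expR (- 2 * q)], make the probability that
   block [n] stays below its level at least [expR (- ln n)], and make the probabilities for the
   initial segments summable. *)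
have qz : \forall n \near \oo, [/\ q (z n) <= 1 / 2,
    2 * ((2 ^ n ^ 2)%:R * q (z n)) <= ln n%:R &
    (2 ^ n.-1 ^ 2)%:R * q (z n) <= expR C * expR (- (1 + 1) * ln n%:R)].
  have tn := cvg_comp _ _ Xy (cvg_add_littleo_pinfty (- (1 - e))
    (@cvg_lnln_pinfty R) (@littleo_lnln R)) _ tail_up.
  have llX := cvg_comp _ _ Xy (@cvg_lnln_pinfty R).
  (* With this constant [2 * ln n] is at most [n * ln 2 / 2], so that [ln (X n)] and [2 * ln n] fit
     together into the gap [(2 * n - 1) * ln 2] between the logarithms of [2 ^ (n ^ 2)] and
     [2 ^ (n.-1 ^ 2)]. *)
  have ln24 : 0 < ln 2 / 4 :> R by rewrite divr_gt0// ln2_gt0.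
  have lnn := near_natr_pinfty (littleo_ln ln24).
  near=> n.
  have n0 : (0 < n)%N by near: n; exact: nbhs_infty_gt.
  have nR0 : 0 < n%:R :> R by rewrite ltr0n.
  have tz : q (z n) <= expR (C - (X n - (1 - e) * ln (ln (X n)))).
    by rewrite /z -mulNr; near: n; exact: tn.
  have lln : (C + ln 4) / e <= ln (ln (X n)).
    by near: n; move/cvgryPge : llX; exact.
  have lln0 : 0 <= ln (ln (X n)) by near: n; move/cvgryPge : llX; exact.
  have lX0 : 0 < ln (X n).
    by near: n; move/cvgryPgt : (cvg_comp _ _ Xy (@cvg_ln_pinfty R)); exact.
  have lnn4 : ln n%:R <= ln 2 / 4 * n%:R :> R by near: n; exact: lnn.
  have lX : ln (X n) <= 2 * ln n%:R.
    rewrite /X /x lnM ?posrE ?ln2_gt0 ?ltr0n ?expn_gt0 ?n0//.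
    rewrite natrX lnXn// mulr_natl gerDl ln_le0//.
    by apply: (@le_ln1Dx R 1); lra.
  have lllX : (1 - e) * ln (ln (X n)) <= ln (X n).
    apply: le_trans (ltW (ln_sublinear lX0)); rewrite ler_piMl//; lra.
  have W : expR (C + (1 - e) * ln (ln (X n))) <= ln n%:R / 2.
    rewrite (_ : C + _ = ln (ln (X n)) - (e * ln (ln (X n)) - C)); last by ring.
    rewrite expRD lnK ?posrE// expRN.
    have e4 : 4 <= expR (e * ln (ln (X n)) - C).
      by rewrite -[leLHS]lnK ?posrE// ler_expR lerBrDl mulrC -ler_pdivrMr.
    rewrite ler_pdivrMr ?expR_gt0//.
    have : ln n%:R / 2 * 4 <= ln n%:R / 2 * expR (e * ln (ln (X n)) - C).
      by rewrite ler_wpM2l//; lra.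
    lra.
  have D0 : 0 < (2 ^ n ^ 2)%:R :> R by rewrite ltr0n expn_gt0.
  have Dq : 2 * ((2 ^ n ^ 2)%:R * q (z n)) <= ln n%:R.
    rewrite mulrC -ler_pdivlMr// (le_trans _ W)//.
    rewrite (le_trans (ler_wpM2l (ltW D0) tz))// -expR_nat_ln2 -expRD ler_expR.
    by rewrite le_eqVlt; apply/orP; left; apply/eqP; rewrite /X /x; ring.
  split => //.
    rewrite -(ler_pM2l D0) mul1r.
    have : ln n%:R <= (2 ^ n ^ 2)%:R :> R.
      rewrite (le_trans (ltW (ln_sublinear nR0)))// ler_nat.
      rewrite (leq_trans (ltnW (ltn_expl n (isT : (1 < 2)%N))))//.
      by rewrite leq_exp2l// -mulnn leq_pmulr.
    lra.
  rewrite (le_trans (ler_wpM2l _ tz))// -expR_nat_ln2 -!expRD ler_expR.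
  have n1R : n.-1%:R = n%:R - 1 :> R by rewrite -subn1 natrB.
  have ln2n : ln 2 <= ln 2 * n%:R :> R by rewrite ler_peMr ?ler1n// ltW// ln2_gt0.
  have XE : X n = n%:R ^+ 2 * ln 2 by rewrite /X /x natrX.
  rewrite natrX n1R; move: lX lllX; rewrite XE.
  set t := (1 - e) * _; set s := ln (_ * _).
  lra.
pose b n := index_iota (2 ^ n.-1 ^ 2) (2 ^ n ^ 2).
(* The block containing [i]; index 0 lies in no block and takes the default label. Through [c] the
   level becomes a function of the index, so the events [A i] form a single independent family. *)
pose c i := xget 0%N [set n | i \in b n].
have bb m n i : (m < n)%N -> i \in b m -> i \notin b n.
  case: n => // n mn; rewrite !mem_index_iota => /andP[_ im].
  rewrite negb_and -ltnNge (leq_trans im)// leq_exp2l//.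
  by rewrite leq_sqr.
have cE n i : i \in b n -> c i = n.
  move=> ibn; have ibc : i \in b (c i).
    by rewrite /c; case: xgetP => [m _ //|/(_ n)]; rewrite /= ibn.
  have [lt|lt|//] := ltngtP (c i) n; exfalso.
    by move: ibn; apply/negP; exact: bb lt ibc.
  by move: ibc; apply/negP; exact: bb lt ibn.
pose A i := ~` G (z (c i)) i.
have mA i : measurable (A i) by exact: measurableC.
pose En n := [set w | forall i, i \in b n -> A i w].
have mEn n : measurable (En n).
  rewrite (_ : En n = \bigcap_(i in [set` b n]) A i)//.
  by apply: bigcap_measurableType => i _.
have HA s : uniq s ->
    fine (P [set w | forall j, j \in s -> A j w]) = \prod_(j <- s) fine (P (A j)).
  by move=> us; rewrite pr_all_le//; apply: eq_bigr => j _; rewrite pr_setC// prG.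
pose F n := [set w | exists2 i, (i < 2 ^ n.-1 ^ 2)%N & G (z n) i w].
have mF n : measurable (F n) by exact: (measurable_exists_lt _ (mG (z n))).
have aeF : {ae P, forall w, exists N, forall n, (N <= n)%N -> ~ F n w}.
  apply: (borel_cantelli_pseries (K := expR C) ltr01 mF).
  near=> n; rewrite (le_trans (pr_exists_lt P _ (mG (z n))))//.
  rewrite (eq_bigr (fun=> q (z n))) => [|i _]; last exact: prG.
  rewrite sumr_const card_ord -[leLHS]mulr_natl.
  by near: n; apply: filterS qz => n [].
have aeE : {ae P, forall w, forall N, exists2 n, (N <= n)%N & En n w}.
  apply: borel_cantelli_second => //.
    exact: (indep_blocks HA (fun n => iota_uniq _ _) cE).
  move=> N0 B; have [N1 _ HN] := qz; pose N := maxn 1 (maxn N0 N1).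
  have [n Nn Bn] : exists2 n, (N <= n)%N & B + ln N%:R <= ln n%:R :> R.
    have lly : \forall x \near +oo, B + ln N%:R <= ln x :> R.
      by move/cvgryPge : (@cvg_ln_pinfty R); exact.
    have [M _ HM] := near_natr_pinfty lly.
    by exists (maxn N M); [exact: leq_maxl|apply: HM; exact: leq_maxr].
  have N0N : (N0 <= N)%N by rewrite !leq_max leqnn orbT.
  exists n; rewrite (big_cat_nat N0N Nn)/=.
  rewrite -[leLHS]add0r lerD//; first by apply: sumr_ge0 => i _; exact: pr_ge0.
  have N1' : (0 < N)%N by rewrite leq_max leqnn.
  apply: (@le_trans _ _ (\sum_(N <= i < n) expR (- ln i%:R))).
    by apply: le_trans (sum_harmonic_ge R N1' Nn); rewrite lerBrDr.
  apply: ler_sum_nat => i /andP[Ni _].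
  have N1i : (N1 <= i)%N by rewrite (leq_trans _ Ni)// !leq_max leqnn !orbT.
  have [q12 ql _] := HN i N1i.
  rewrite HA ?iota_uniq//.
  rewrite big_seq (eq_bigr (fun=> 1 - q (z i))) => [|j jb]; last first.
    by rewrite pr_setC// prG (cE _ _ jb).
  rewrite -big_seq.
  apply: (@le_trans _ _ (\prod_(j <- b i) expR (- 2 * q (z i)))); last first.
    apply: ler_prod => j _; rewrite expR_ge0/= expR_le_one_sub//.
    by rewrite q_ge0.
  rewrite -expR_sum ler_expR sumr_const_nat -[leRHS]mulr_natl mulNr mulrN lerN2.
  apply: le_trans ql.
  rewrite mulrCA ler_wpM2l// ler_wpM2r// ler_nat.
  exact: leq_subr.
move: aeF aeE; apply: filterS2 => w [N1 HF] HE N.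
have [n] := HE (maxn N N1); rewrite geq_max => /andP[Nn N1n] En_w.
exists n => // i i2n; rewrite leNgt; apply/negP => Gi.
have [ib|ib] := ltnP i (2 ^ n.-1 ^ 2).
  by apply: (HF n N1n); exists i.
have ibn : i \in b n by rewrite mem_index_iota ib.
by have := En_w _ ibn; rewrite /A (cE _ _ ibn); exact.
Unshelve. all: by end_near.
Qed.

End record_levels.

(** * The running maximum of a regenerative process *)

Section limsup_real.
Variable R : realType.
Local Open Scope ereal_scope.

Lemma limf_esup_pinfty_eq (f : R -> \bar R) (a : R) :
  (forall e : R, (0 < e)%R -> \forall t \near +oo%R, f t <= (a + e)%:E) ->
  (forall e A : R, (0 < e)%R -> exists2 t, (A <= t)%R & (a - e)%:E <= f t) ->
  limf_esup f (pinfty_nbhs R) = a%:E.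
Proof.
move=> fub flb; apply/eqP; rewrite eq_le; apply/andP; split.
  apply/lee_addgt0Pr => e e0.
  apply: ereal_inf_le; exists (ereal_sup (f @` [set t | f t <= (a + e)%:E])).
    by exists [set t | f t <= (a + e)%:E] => //; exact: fub.
  by apply: ge_ereal_sup => _ [t /= ft <-].
apply: le_ereal_inf_tmp => _ [V Vy <-].
apply/lee_subgt0Pr => e e0.
have [A [_ AV]] := Vy.
have [t At ft] := flb e (A + 1)%R e0.
apply: le_trans ft _; apply: ereal_sup_ubound; exists t => //.
by apply: AV; rewrite (lt_le_trans _ At)// ltrDl.
Qed.

Lemma limf_einf_pinfty_eq (f : R -> \bar R) (a : R) :
  (forall e : R, (0 < e)%R -> \forall t \near +oo%R, (a - e)%:E <= f t) ->
  (forall e A : R, (0 < e)%R -> exists2 t, (A <= t)%R & f t <= (a + e)%:E) ->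
  limf_einf f (pinfty_nbhs R) = a%:E.
Proof.
move=> flb fub; rewrite /limf_einf (@limf_esup_pinfty_eq _ (- a)%R) ?EFinN ?oppeK//.
  move=> e e0; apply: filterS (flb e e0) => t.
  by rewrite -(opprK e) -opprD EFinN leeN2 opprK.
move=> e A e0; have [t At ft] := fub e A e0; exists t => //.
by rewrite -opprD EFinN leeN2.
Qed.

Lemma normalized_le (r L v a : R) (x : \bar R) : (0 < r)%R -> (0 < L)%R ->
  x <= v%:E -> r%:E * (x - a%:E) / L%:E <= (r * (v - a) / L)%:E.
Proof.
move=> r0 L0 xv.
rewrite inver gt_eqF// EFinM lee_pmul2r ?lte_fin ?invr_gt0//.
by rewrite EFinM lee_pmul2l ?lte_fin// EFinB leeB.
Qed.

Lemma normalized_ge (r L v a : R) (x : \bar R) : (0 < r)%R -> (0 < L)%R ->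
  v%:E <= x -> (r * (v - a) / L)%:E <= r%:E * (x - a%:E) / L%:E.
Proof.
move=> r0 L0 xv.
rewrite inver gt_eqF// EFinM lee_pmul2r ?lte_fin ?invr_gt0//.
by rewrite EFinM lee_pmul2l ?lte_fin// EFinB leeB.
Qed.

End limsup_real.

(** * Deterministic passage from period maxima to the running maximum *)

Section pathwise.
Variables (R : realType) (H l : R -> R) (alpha c C : R).
Variables (S : nat -> R) (M : nat -> \bar R) (Xb : R -> \bar R).
Hypotheses (UH : conditionU H) (ly : l x @[x --> +oo] --> +oo)
  (lo : forall e, 0 < e -> \forall x \near +oo, l x <= e * x)
  (lK : forall K, \forall x \near +oo, forall x', `|x' - x| <= K ->
     `|l x' - l x| <= 1)
  (ro : littleo_pinfty (fun x => (H^`())%classic (ginv H x)) l).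
Hypotheses (alpha0 : 0 < alpha) (c0 : 0 < c) (C0 : 0 < C)
  (Xb_mono : forall s t, s <= t -> (Xb s <= Xb t)%E)
  (XbS : forall k (v : R), (Xb (S k) <= v%:E)%E <->
    forall i, (i < k)%N -> (M i <= v%:E)%E)
  (S_mono : forall m n, (m <= n)%N -> S m <= S n)
  (S_growth : exists N, forall k, (N <= k)%N -> c * k%:R <= S k <= C * k%:R).

Let g := ginv H.
Let r := (H^`())%classic.
Let A0 (t : R) := g (ln (t / alpha)).
Let Nm (t : R) := ((r (A0 t))%:E * (Xb t - (A0 t)%:E) / (l (ln t))%:E)%E.
(** The factors 2 leave room for [t] anywhere between two consecutive dyadic epochs, and for [i]
    against [i + 1]; the last term also covers the distance from [ln t] to [ln (t / alpha)]. *)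
Let K := `|ln (c / 2)| + `|ln (2 * C)| + `|ln alpha|.

Let log_close (a t : R) : 0 < a -> c / 2 * a <= t -> t <= 2 * C * a ->
  `|ln a - ln (t / alpha)| <= K.
Proof.
move=> a0 ta at_.
have ca0 : 0 < c / 2 by rewrite divr_gt0.
have Ca0 : 0 < 2 * C by rewrite mulr_gt0.
have t0 : 0 < t by apply: lt_le_trans ta; rewrite mulr_gt0.
have : ln (c / 2 * a) <= ln t by rewrite ler_ln ?posrE ?mulr_gt0.
have : ln t <= ln (2 * C * a) by rewrite ler_ln ?posrE ?mulr_gt0.
rewrite ln_div ?posrE// (@lnM _ (c / 2) a) ?posrE// (@lnM _ (2 * C) a) ?posrE//.
rewrite /K => tle tge.
have := ler_norm (ln (c / 2)); have := ler_norm (- ln (c / 2)).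
have := ler_norm (ln (2 * C)); have := ler_norm (- ln (2 * C)).
have := ler_norm (ln alpha); have := ler_norm (- ln alpha).
have := normr_ge0 (ln (c / 2)); have := normr_ge0 (ln (2 * C)).
rewrite !normrN ler_norml => *; apply/andP; split; lra.
Qed.

Let level_close (y e : R) : 0 < e -> \forall t \near +oo,
  [/\ 0 < r (A0 t), 0 < l (ln t) &
  forall x' s, `|x' - ln (t / alpha)| <= K -> `|s| <= 1 ->
    `|r (A0 t) * (g (x' + y * l x') + s - A0 t) / l (ln t) - y| <= e].
Proof.
move=> e0.
have lnt : ln (t / alpha) @[t --> +oo] --> (+oo : set_system R).
  apply: (cvg_comp _ _ _ (@cvg_ln_pinfty R)); apply/cvgryPge => A; near=> t.
  rewrite ler_pdivlMr//; near: t; apply: nbhs_pinfty_ge; exact: num_real.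
have [b [X0 [_ gP _ _]]] := conditionU_ginv UH.
have rt : \forall x \near +oo, 0 < r (g x).
  near=> x.
  have Xx : X0 <= x by near: x; apply: nbhs_pinfty_ge; exact: num_real.
  by have [] := gP _ Xx.
have lt : \forall t \near +oo, 0 < l (ln t).
  by move/cvgryPgt : (cvg_comp _ _ (@cvg_ln_pinfty R) ly); exact.
have lev := ginv_level_asymptotics K y UH ly lo lK ro e0.
near=> t; split.
- by near: t; exact: (lnt _ rt).
- by near: t.
- have t0 : 0 < t by near: t; apply: nbhs_pinfty_gt; exact: num_real.
  have lnta : `|ln t - ln (t / alpha)| <= K.
    rewrite ln_div ?posrE// opprB addrC subrK /K.
    by rewrite lerDr addr_ge0.
  have : forall x' x'' s, `|x' - ln (t / alpha)| <= K ->
    `|x'' - ln (t / alpha)| <= K -> `|s| <= 1 ->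
    `|r (g (ln (t / alpha))) * (g (x' + y * l x') + s - g (ln (t / alpha))) /
      l x'' - y| <= e by near: t; exact: (lnt _ lev).
  by move=> Hl x' s x't s1; exact: Hl.
Unshelve. all: by end_near.
Qed.

Let Sy : S k @[k --> \oo] --> +oo.
Proof.
have [N SN] := S_growth; apply/cvgryPge => A; near=> k.
have /andP[+ _] : c * k%:R <= S k <= C * k%:R by apply: SN; near: k; exact: nbhs_infty_ge.
apply: le_trans; rewrite -ler_pdivrMl//; near: k; exact: nbhs_infty_ger.
Unshelve. all: by end_near.
Qed.

Let x (n : nat) : R := n%:R * ln 2.

Let xE n : x n = ln (2 ^+ n).
Proof. by rewrite /x lnXn// mulr_natl. Qed.

(** [n + 1] is the least exponent whose epoch is at least [t]. Both logarithms are kept close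
    because lower bounds on the running maximum use the epoch before [t] and upper bounds the one
    after. *)
Let dyadic_time N0 : \forall t \near +oo, exists n, [/\ (N0 <= n)%N,
  S (2 ^ n) <= t <= S (2 ^ n.+1),
  `|x n - ln (t / alpha)| <= K & `|x n.+1 - ln (t / alpha)| <= K].
Proof.
have [N SN] := S_growth.
near=> t.
have tS : S (2 ^ maxn N0 N) < t by near: t; apply: nbhs_pinfty_gt; exact: num_real.
have : exists n, t <= S (2 ^ n).
  have St : \forall k \near \oo, t <= S k by move/cvgryPge : Sy; exact.
  have [k _ Sk] := St; exists k; apply: Sk.
  exact: (ltnW (ltn_expl k (isT : (1 < 2)%N))).
move=> /ex_minnP[m tm mP].
have lt_m : (maxn N0 N < m)%N.
  rewrite ltnNge; apply: contraTN tm => mN; rewrite -ltNge.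
  by apply: le_lt_trans tS; apply: S_mono; rewrite leq_exp2l.
case: m tm mP lt_m => // n tn nP; rewrite ltnS geq_max => /andP[N0n Nn].
have Stn : S (2 ^ n) < t.
  by rewrite ltNge; apply/negP => /nP; rewrite ltnn.
have N2n k : (N <= k)%N -> (N <= 2 ^ k)%N.
  by move=> Nk; rewrite (leq_trans Nk)// (ltnW (ltn_expl k (isT : (1 < 2)%N))).
have /andP[Sl _] := SN _ (N2n _ Nn).
have /andP[_ Su] := SN _ (N2n _ (leqW Nn)).
rewrite natrX in Sl; rewrite natrX in Su.
have p0 : 0 < 2 ^+ n :> R by rewrite exprn_gt0.
have cp : 0 < c * 2 ^+ n by rewrite mulr_gt0.
have Cp : 0 < C * 2 ^+ n by rewrite mulr_gt0.
exists n; split => //.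
- by rewrite (ltW Stn) tn.
- by rewrite xE; apply: log_close => //; rewrite (exprS 2 n) in Su; lra.
- rewrite xE; apply: log_close; rewrite (exprS 2 n) in Su *; lra.
Unshelve. all: by end_near.
Qed.

Lemma normalized_upper (y e : R) : 0 < e ->
  (exists N, forall n, (N <= n)%N -> forall i, (i < 2 ^ n)%N ->
    (M i <= (g (x n + y * l (x n)) + 1)%:E)%E) ->
  \forall t \near +oo, (Nm t <= (y + e)%:E)%E.
Proof.
move=> e0 [N MN].
have := level_close y e0; have := dyadic_time N.
apply: filterS2 => t [n [Nn /andP[_ tS] _ xn]] [r0 l0 lev].
apply: (@le_trans _ _ (r (A0 t) * ((g (x n.+1 + y * l (x n.+1)) + 1) - A0 t) /
  l (ln t))%:E).
  apply: normalized_le => //; apply: le_trans (Xb_mono tS) _.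
  by apply/XbS; apply: MN; exact: leqW.
have := lev _ 1 xn; rewrite normr1 lexx => /(_ isT).
by rewrite lee_fin ler_norml => /andP[_]; rewrite lerBlDl.
Qed.

Lemma normalized_lower (y e : R) : 0 < e ->
  (exists N, forall n, (N <= n)%N -> exists2 i, (i < 2 ^ n)%N &
    ((g (x n + y * l (x n)) - 1)%:E < M i)%E) ->
  \forall t \near +oo, ((y - e)%:E <= Nm t)%E.
Proof.
move=> e0 [N MN].
have := level_close y e0; have := dyadic_time N.
apply: filterS2 => t [n [Nn /andP[St _] xn _]] [r0 l0 lev].
apply: (@le_trans _ _ (r (A0 t) * ((g (x n + y * l (x n)) - 1) - A0 t) /
  l (ln t))%:E).
  have := lev _ (-1) xn; rewrite normrN1 lexx => /(_ isT).
  by rewrite lee_fin ler_norml => /andP[+ _]; rewrite lerBrDl.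
apply: normalized_ge => //; apply: le_trans (Xb_mono St).
have [i i2n Mi] := MN n Nn.
rewrite leNgt; apply/negP => /ltW/XbS/(_ i i2n).
by rewrite leNgt Mi.
Qed.

Lemma normalized_lower_often (y e A : R) : 0 < e ->
  (forall N, exists2 i, (N <= i)%N &
    ((g (ln i%:R + y * l (ln i%:R)) - 1)%:E < M i)%E) ->
  exists2 t, A <= t & ((y - e)%:E <= Nm t)%E.
Proof.
move=> e0 MN; have [B [_ lev]] := level_close y e0.
have [N SN] := S_growth.
have SA : \forall k \near \oo, Num.max A (B + 1) <= S k.
  by move/cvgryPge : Sy; exact.
have [N' _ SN'] := SA.
have [i Ni Mi] := MN (maxn 1 (maxn N N')).
have [i1 Ni1 N'i1] : [/\ (1 <= i)%N, (N <= i.+1)%N & (N' <= i.+1)%N].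
  by move: Ni; rewrite !geq_max => /and3P[-> /leqW -> /leqW ->].
have := SN' _ N'i1; rewrite /= ge_max => /andP[AS BS].
(* Periods are counted from 0, so [S i.+1] is the end of period [i], the first epoch at which its
   maximum is sure to be included. *)
exists (S i.+1) => //.
have [|r0 l0 {}lev] := lev (S i.+1); first by rewrite (lt_le_trans _ BS)// ltrDl.
have i0 : 0 < i%:R :> R by rewrite ltr0n.
have iR : 1 <= i%:R :> R by rewrite ler1n.
have xi : `|ln i%:R - ln (S i.+1 / alpha)| <= K.
  have /andP[Sl Su] := SN _ Ni1.
  rewrite -natr1 in Sl Su.
  have ci : 0 < c * i%:R by rewrite mulr_gt0.
  have Ci : C * 1 <= C * i%:R by rewrite ler_pM2l.
  have c_gt0 := c0.
  apply: log_close => //; lra.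
apply: (@le_trans _ _ (r (A0 (S i.+1)) * ((g (ln i%:R + y * l (ln i%:R)) - 1) -
  A0 (S i.+1)) / l (ln (S i.+1)))%:E).
  have := lev _ (-1) xi; rewrite normrN1 lexx => /(_ isT).
  by rewrite lee_fin ler_norml => /andP[+ _]; rewrite lerBrDl.
apply: normalized_ge => //.
rewrite leNgt; apply/negP => /ltW/XbS/(_ i (ltnSn i)).
by rewrite leNgt Mi.
Qed.

Lemma normalized_upper_often (y e A : R) : 0 < e ->
  (forall N, exists2 n, (N <= n)%N & forall i, (i < 2 ^ (n ^ 2))%N ->
    (M i <= (g (x (n ^ 2) + y * l (x (n ^ 2))) + 1)%:E)%E) ->
  exists2 t, A <= t & (Nm t <= (y + e)%:E)%E.
Proof.
move=> e0 MN; have [B [_ lev]] := level_close y e0.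
have [N SN] := S_growth.
have SA : \forall k \near \oo, Num.max A (B + 1) <= S k.
  by move/cvgryPge : Sy; exact.
have [N' _ SN'] := SA.
have [n] := MN (maxn N N'); set k := (2 ^ (n ^ 2))%N => Nn Mk.
have nk : (n <= k)%N.
  rewrite (leq_trans (ltnW (ltn_expl n (isT : (1 < 2)%N))))//.
  by rewrite leq_exp2l// -mulnn; case: n {Nn Mk k} => // n; rewrite leq_pmulr.
have [Nk N'k] : (N <= k)%N /\ (N' <= k)%N.
  by move: Nn; rewrite geq_max => /andP[? ?]; split; apply: leq_trans nk.
have := SN' _ N'k; rewrite /= ge_max => /andP[AS BS].
exists (S k) => //.
have [|r0 l0 {}lev] := lev (S k); first by rewrite (lt_le_trans _ BS)// ltrDl.
have k0 : 0 < k%:R :> R by rewrite ltr0n expn_gt0.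
have xk : `|x (n ^ 2) - ln (S k / alpha)| <= K.
  have /andP[Sl Su] := SN _ Nk.
  have ck : 0 < c * k%:R by rewrite mulr_gt0.
  have Ck : 0 < C * k%:R by rewrite mulr_gt0.
  by rewrite xE -natrX; apply: log_close => //; lra.
apply: (@le_trans _ _ (r (A0 (S k)) * ((g (x (n ^ 2) + y * l (x (n ^ 2))) + 1) -
  A0 (S k)) / l (ln (S k)))%:E).
  by apply: normalized_le => //; apply/XbS.
have := lev _ 1 xk; rewrite normr1 lexx => /(_ isT).
by rewrite lee_fin ler_norml => /andP[_]; rewrite lerBlDl.
Qed.

End pathwise.

Section running_maximum.
Variable R : realType.
Local Open Scope ereal_scope.

Lemma runmax_leP (f : R -> R) (t v : R) :
  runmax f t <= v%:E <-> forall s, (0 <= s < t)%R -> (f s <= v)%R.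
Proof.
split=> [ftv s st|fv].
  rewrite -lee_fin; apply: le_trans ftv; apply: ereal_sup_ubound.
  by exists s => //=; rewrite in_itv.
by apply: ge_ereal_sup => _ [s /= + <-]; rewrite in_itv/= lee_fin; exact: fv.
Qed.

Lemma runmax_gtP (f : R -> R) (t v : R) :
  v%:E < runmax f t <-> exists2 s, (0 <= s < t)%R & (v < f s)%R.
Proof.
split=> [vf|[s st vs]].
  have [_ [s /= st <-] vs] := ereal_sup_gt vf.
  by exists s; [move: st; rewrite in_itv|].
apply: (@lt_le_trans _ _ (f s)%:E); first by rewrite lte_fin.
by apply: ereal_sup_ubound; exists s => //=; rewrite in_itv.
Qed.

Lemma le_runmax (f : R -> R) (s t : R) : (s <= t)%R -> runmax f s <= runmax f t.
Proof.
move=> st; apply: le_ereal_sup => _ [u /= us <-]; exists u => //=.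
by move: us; rewrite !in_itv/= => /andP[-> /= us]; exact: lt_le_trans st.
Qed.

(* A random time is handled through the rational times before it. *)
Lemma measurable_runmax_gt (v : R) :
  measurable [set p : R * sample_path R | v%:E < runmax p.2 p.1].
Proof.
rewrite (_ : [set p | _] = \bigcup_(a : rat)
  ([set p : R * sample_path R | (0 <= ratr a :> R)%R /\ (ratr a < p.1)%R] `&`
   [set p : R * sample_path R | v%:E < runmax p.2 (ratr a)])).
  apply: bigcupT_measurable_rat => a.
  have [a0|a0] := leP 0%R (ratr a : R); last first.
    rewrite (_ : _ `&` _ = set0)//.
    by apply/seteqP; split=> p //= [[]].
  apply: measurableI.
    rewrite (_ : [set p | _] = fst @^-1` `]ratr a, +oo[%classic); last first.
      by apply/seteqP; split=> p /=; rewrite in_itv/= andbT => // -[].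
    by rewrite -[X in measurable X]setTI; exact: measurable_fst.
  rewrite (_ : [set p | _] = snd @^-1`
    [set f : sample_path R | v%:E < runmax f (ratr a)])//.
  rewrite -[X in measurable X]setTI; apply: measurable_snd => //.
  apply: sub_sigma_algebra; exists (ratr a) => //; right.
  exists `]v%:E, +oo]%classic; first exact: emeasurable_itv.
  by apply/seteqP; split=> f /=; rewrite in_itv/= leey andbT.
apply/seteqP; split=> p /=.
  move=> /runmax_gtP[s /andP[s0 st] vs].
  have [a] := rat_in_itvoo st; rewrite in_itv/= => /andP[sa at_].
  exists a => //=; split; first by rewrite (le_trans s0 (ltW sa)).
  by apply/runmax_gtP; exists s; rewrite ?s0.
move=> [a _ /= [[a0 ap] va]]; apply: (lt_le_trans va).
by apply: le_runmax; exact: ltW.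
Qed.

End running_maximum.

(** * Regenerative paths: epochs, cycles and the tail of a period maximum *)

Section regenerative_process.
Context {d : measure_display} {Omega : measurableType d} {R : realType}.
Variables (P : probability Omega R)
  (Y : nat -> {RV P >-> (R * sample_path R)%type}) (X : R -> Omega -> R).
Hypothesis regX : regenerative Y X.

Let periodP k w : 0 < period Y k w. Proof. by case: regX. Qed.

Let epochS k w : epoch Y k.+1 w = epoch Y k w + period Y k w.
Proof. by rewrite /epoch big_ord_recr. Qed.

Lemma le_epoch w (m n : nat) : (m <= n)%N -> epoch Y m w <= epoch Y n w.
Proof.
move=> mn; rewrite -(subnK mn); elim: (n - m)%N => // k IH.
by rewrite addSn epochS (le_trans IH)// lerDl ltW.
Qed.

Let X_cycle k w s : 0 <= s < period Y k w ->
  X (epoch Y k w + s) w = Defs.cycle_path Y k w s.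
Proof.
move=> /andP[s0 sT]; have [_ _ _ _ Xcyc] := regX.
rewrite (Xcyc k); first by rewrite addrC addKr.
by rewrite lerDl s0 epochS ltrD2l.
Qed.

(** Every time before epoch [k] lies in one of the first [k] periods, where the path is a shifted
    cycle. Comparison with real levels is the form in which the pathwise estimates use the
    maxima. *)
Lemma runmax_epoch_leP w (k : nat) (v : R) :
  (runmax (X^~ w) (epoch Y k w) <= v%:E)%E <->
  forall i, (i < k)%N -> (runmax (Y i w).2 (Y i w).1 <= v%:E)%E.
Proof.
split=> [/runmax_leP H i ik|H].
  apply/runmax_leP => s sT; rewrite -[(Y i w).2 s]/(Defs.cycle_path Y i w s).
  rewrite -(X_cycle sT); apply: H.
  case/andP : sT => s0 sT; apply/andP; split.
    by rewrite addr_ge0// -[leLHS](_ : epoch Y 0 w = 0) ?le_epoch// /epoch big_ord0.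
  by apply: lt_le_trans (le_epoch w ik); rewrite epochS ltrD2l.
apply/runmax_leP => s /andP[s0 sk].
suff [i ik /andP[is_ si]] : exists2 i, (i < k)%N & epoch Y i w <= s < epoch Y i.+1 w.
  have sT : 0 <= s - epoch Y i w < period Y i w.
    by rewrite subr_ge0 is_ ltrBlDl -epochS.
  rewrite -(subrK (epoch Y i w) s) addrC (X_cycle sT).
  by have /runmax_leP := H i ik; exact.
elim: k sk {H} => [|k IH] sk; first by move: sk; rewrite /epoch big_ord0 ltNge s0.
have [sk'|ks] := ltP s (epoch Y k w).
  by have [i ik si] := IH sk'; exists i => //; exact: leqW.
by exists k => //; rewrite ks.
Qed.

Lemma runmax_first_period w : runmax (X^~ w) (period Y 0 w) = runmax (Y 0 w).2 (Y 0 w).1.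
Proof.
rewrite /runmax; congr (ereal_sup _); apply: eq_imagel => s /=; rewrite in_itv/= => sT.
by rewrite -[(Y 0 w).2 s]/(Defs.cycle_path Y 0 w s) -(X_cycle sT) /epoch big_ord0 add0r.
Qed.

Lemma epoch_linear_growth : ('E_P[period Y 0] < +oo)%E ->
  exists c C : R, [/\ 0 < c, 0 < C & {ae P, forall w, exists N, forall k,
    (N <= k)%N -> c * k%:R <= epoch Y k w <= C * k%:R}].
Proof.
have [_ indY idY _ _] := regX; move=> ET.
have mT k : measurable_fun setT (period Y k) by exact: measurableT_comp.
pose T k : {RV P >-> R} :=
  HB.pack_for {mfun Omega >-> R} (period Y k) (isMeasurableFun.Build _ _ _ _ _ (mT k)).
apply: (@renewal_linear_growth _ _ _ P T) => //.
- move=> J B mB.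
  have := indY J (fun k => fst @^-1` B k).
  apply => k /mB mBk; rewrite -[X in measurable X]setTI.
  exact: measurable_fst.
- move=> k B mB; apply: (idY k (fst @^-1` B)).
  by rewrite -[X in measurable X]setTI; exact: measurable_fst.
- by move: ET; rewrite unlock.
Qed.

Lemma mean_period_gt0 : ('E_P[period Y 0] < +oo)%E -> 0 < fine 'E_P[period Y 0].
Proof.
rewrite unlock => ET; rewrite fine_gt0// ET andbT; apply: integral_gt0 => //.
exact: measurableT_comp.
Qed.

End regenerative_process.

(** The tail is prescribed at integers only, so [ginv R0 x] is rounded: the integer part of
    [ginv R0 x + 1] is above [ginv R0 x], and that of [ginv R0 x] is above [ginv R0 x - 1].
    Monotonicity of [R0] and of the tail gives the two bounds, [R1] costing the factor [expR C1]. *)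
Lemma cycle_max_tail {d : measure_display} {Omega : measurableType d}
    {R : realType} (P : probability Omega R)
    (Y : nat -> {RV P >-> (R * sample_path R)%type}) (X : R -> Omega -> R)
    (R0 R1 : R -> R) (C1 : R) :
  regenerative Y X ->
  (forall k : nat,
     (- lne (P [set w | k%:R%:E < runmax (X^~ w) (period Y 0 w)]))%E
     = (R0 k%:R + R1 k%:R)%:E) ->
  (forall k : nat, `|R1 k%:R| <= C1) ->
  conditionU R0 ->
  let q v := fine (P [set w | (v%:E < runmax (Y 0%N w).2 (Y 0%N w).1)%E]) in
  (\forall x \near +oo, q (ginv R0 x + 1) <= expR (C1 - x)) /\
  (\forall x \near +oo, expR (- C1 - x) <= q (ginv R0 x - 1)).
Proof.
move=> regX tailX R1C UR0 q.
have qE (k : nat) : q k%:R = expR (- (R0 k%:R + R1 k%:R)).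
  have := tailX k; under eq_fun do rewrite (runmax_first_period regX).
  move/(congr1 oppe); rewrite oppeK => lq.
  by rewrite /q -[P _]lneK ?lq ?in_itv/= ?measure_ge0 ?leey.
have mq v : measurable [set w | (v%:E < runmax (Y 0%N w).2 (Y 0%N w).1)%E].
  exact: (measurable_funPTI (Y 0%N) (measurable_runmax_gt v)).
have q_anti u v : u <= v -> q v <= q u.
  by move=> uv; apply: le_pr => // w /=; apply: le_lt_trans; rewrite lee_fin.
have [b [X0 [R0mono gP gy _]]] := conditionU_ginv UR0.
have near_g A : \forall x \near +oo, A <= ginv R0 x by move/cvgryPge : gy; exact.
split; near=> x.
  have Xx : X0 <= x by near: x; apply: nbhs_pinfty_ge; exact: num_real.
  have g0 : 0 <= ginv R0 x by near: x; exact: near_g.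
  have [bg gx _] := gP _ Xx.
  have /andP[kl ku] := truncn_itv (addr_ge0 g0 ler01).
  apply: (le_trans (q_anti _ _ kl)); rewrite qE ler_expR.
  set k := Num.truncn _ in kl ku *.
  have : R0 (ginv R0 x) <= R0 k%:R.
    by apply: R0mono => //; move: ku; rewrite -natr1; lra.
  have := R1C k; rewrite gx ler_norml => /andP[? _] ?; lra.
have Xx : X0 <= x by near: x; apply: nbhs_pinfty_ge; exact: num_real.
have g0 : 0 <= ginv R0 x by near: x; exact: near_g.
(* The extra 1 keeps the rounded-down integer at or above [b], where [R0] is monotone. *)
have gb : b + 1 <= ginv R0 x by near: x; exact: near_g.
have [bg gx _] := gP _ Xx.
have /andP[kl] := truncn_itv g0; set k := Num.truncn _ in kl *.
rewrite -natr1 => ku.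
apply: (le_trans _ (q_anti _ k%:R _)); last by lra.
rewrite qE ler_expR.
have : R0 k%:R <= R0 (ginv R0 x) by apply: R0mono => //; lra.
have := R1C k; rewrite gx ler_norml => /andP[_ ?] ?; lra.
Unshelve. all: by end_near.
Qed.

Theorem theorem2 (d : measure_display) (Omega : measurableType d)
    (R : realType) (P : probability Omega R)
    (Y : nat -> {RV P >-> (R * sample_path R)%type}) (X : R -> Omega -> R)
    (R0 R1 : R -> R) (C1 : R) :
  regenerative Y X ->
  (forall t : R, 0 <= t -> P [set w | exists n : nat, X t w = n%:R] = 1%E) ->
  (forall k : nat,
     (- lne (P [set w | k%:R%:E < runmax (X^~ w) (period Y 0 w)]))%E
     = (R0 k%:R + R1 k%:R)%:E) ->
  (forall k : nat, `|R1 k%:R| <= C1) ->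
  conditionU R0 ->
  ('E_P[period Y 0] < +oo)%E ->
  let alphaT := fine ('E_P[period Y 0]) in
  let r0 := (R0^`())%classic in
  let A0 := fun t : R => ginv R0 (ln (t / alphaT)) in
  let Xbar := fun (t : R) (w : Omega) => runmax (X^~ w) t in
  (littleo_pinfty (fun x : R => r0 (ginv R0 x)) (fun x : R => ln x) ->
   {ae P, forall w,
     limf_esup (fun t : R =>
       ((r0 (A0 t))%:E * (Xbar t w - (A0 t)%:E) / (ln (ln t))%:E)%E) (pinfty_nbhs R)
     = 1%E}) /\
  (littleo_pinfty (fun x : R => r0 (ginv R0 x)) (fun x : R => ln (ln x)) ->
   {ae P, forall w,
     limf_einf (fun t : R =>
       ((r0 (A0 t))%:E * (Xbar t w - (A0 t)%:E) / (ln (ln (ln t)))%:E)%E) (pinfty_nbhs R)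
     = (- 1)%E}).
Proof.
move=> regX _ tailX R1C UR0 ET alphaT r0 A0 Xbar.
have [_ indY idY _ _] := regX.
have [tup tlo] := cycle_max_tail regX tailX R1C UR0.
have alpha0 : 0 < alphaT by exact: mean_period_gt0 regX ET.
have [c [C [c0 C0 growth]]] := epoch_linear_growth regX ET.
pose phi (p : R * sample_path R) := runmax p.2 p.1.
have mphi (v : R) : measurable [set p | (v%:E < phi p)%E].
  exact: measurable_runmax_gt.
have Xmono w s t : s <= t -> (Xbar s w <= Xbar t w)%E by exact: le_runmax.
have XbS w (k : nat) (v : R) : (Xbar (epoch Y k w) w <= v%:E)%E <->
    forall i, (i < k)%N -> (phi (Y i w) <= v%:E)%E.
  exact: (runmax_epoch_leP regX).
have Smono w m n : (m <= n)%N -> epoch Y m w <= epoch Y n w.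
  exact: (le_epoch regX).
(* Almost sure events are intersected over countably many tolerances [1 / (m + 1)]; an arbitrary [e]
   is split into halves, one for the choice of [m] and one for the pathwise error. *)
have inv_small (e : R) : 0 < e -> exists m : nat, m.+1%:R^-1 <= e.
  move=> e0; have [N _ HN] := near_infty_natSinv_lt (PosNum e0).
  by exists N; apply/ltW/HN => /=.
split=> ro.
  have up : {ae P, forall w, forall m : nat, exists N, forall n, (N <= n)%N ->
      forall i, (i < 2 ^ n)%N -> (phi (Y i w) <= (ginv R0 (n%:R * ln 2 +
        (1 + m.+1%:R^-1) * ln (n%:R * ln 2)) + 1)%:E)%E}.
    apply/ae_foralln => m; apply: (dyadic_max_upper idY mphi tup).
    by rewrite invr_gt0.
  have lo := individual_records indY idY mphi tlo.
  move: growth up lo; apply: filterS3 => w Gw Uw Lw.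
  apply: limf_esup_pinfty_eq => [e e0|e A e0].
    have e20 : 0 < e / 2 by rewrite divr_gt0.
    have [m me] := inv_small _ e20.
    have := @normalized_upper R R0 (@ln R) alphaT c C _ _ _ UR0 (@cvg_ln_pinfty R)
      (@littleo_ln R) (@ln_bounded_shift R) ro alpha0 c0 C0 (Xmono w) (XbS w)
      (Smono w) Gw _ _ e20 (Uw m).
    apply: filterS => t /le_trans; apply.
    by rewrite lee_fin; move: me; set u := _^-1 => me; lra.
  apply: (@normalized_lower_often R R0 (@ln R) alphaT c C _ _ _ UR0
    (@cvg_ln_pinfty R) (@littleo_ln R) (@ln_bounded_shift R) ro alpha0 c0 C0
    (XbS w) Gw 1 e A e0).
  by move=> N; have [i Ni Mi] := Lw N; exists i => //; rewrite mul1r.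
have lo : {ae P, forall w, forall m : nat, exists N, forall n, (N <= n)%N ->
    exists2 i, (i < 2 ^ n)%N & ((ginv R0 (n%:R * ln 2 -
      (1 + m.+1%:R^-1) * ln (ln (n%:R * ln 2))) - 1)%:E < phi (Y i w))%E}.
  apply/ae_foralln => m; apply: (dyadic_max_lower indY idY mphi tlo).
  by rewrite invr_gt0.
(* [m.+2] in place of [m.+1] keeps the tolerance strictly below 1, as [sparse_max_upper]
   requires. *)
have up : {ae P, forall w, forall m : nat, forall N, exists2 n, (N <= n)%N &
    forall i, (i < 2 ^ (n ^ 2))%N -> (phi (Y i w) <= (ginv R0 ((n ^ 2)%:R * ln 2 -
      (1 - m.+2%:R^-1) * ln (ln ((n ^ 2)%:R * ln 2))) + 1)%:E)%E}.
  apply/ae_foralln => m; apply: (sparse_max_upper indY idY mphi tup).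
    by rewrite invr_gt0.
  by rewrite invf_lt1// ltr1n.
move: growth lo up; apply: filterS3 => w Gw Lw Uw.
rewrite -EFinN; apply: limf_einf_pinfty_eq => [e e0|e A e0].
  have e20 : 0 < e / 2 by rewrite divr_gt0.
  have [m me] := inv_small _ e20.
  have := @normalized_lower R R0 (fun x => ln (ln x)) alphaT c C _ _ _ UR0
    (@cvg_lnln_pinfty R) (@littleo_lnln R) (@lnln_bounded_shift R) ro alpha0 c0 C0
    (Xmono w) (XbS w) (Smono w) Gw (- (1 + m.+1%:R^-1)) _ e20.
  move=> /(_ _)/wrap[].
    have [N HN] := Lw m; exists N => n /HN[i ? ?].
    by exists i => //; rewrite mulNr.
  apply: filterS => t; apply: le_trans.
  by rewrite lee_fin; move: me; set u := _^-1 => me; lra.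
have e20 : 0 < e / 2 by rewrite divr_gt0.
have [m me] := inv_small _ e20.
have [|t At Nt] := @normalized_upper_often R R0 (fun x => ln (ln x)) alphaT c C
  _ _ _ UR0 (@cvg_lnln_pinfty R) (@littleo_lnln R) (@lnln_bounded_shift R) ro
  alpha0 c0 C0 (XbS w) Gw (- (1 - m.+2%:R^-1)) _ A e20.
  move=> N; have [n Nn Hn] := Uw m N; exists n => // i /Hn.
  by rewrite mulNr.
exists t => //; apply: le_trans Nt _.
have : m.+2%:R^-1 <= m.+1%:R^-1 :> R by rewrite lef_pV2 ?posrE// ler_nat.
by rewrite lee_fin; move: me; set u := m.+1%:R^-1; set u' := m.+2%:R^-1; lra.
Qed.
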